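(* There is an absolute constant $C>0$ such that the following holds. Let $n\ge 6$ and $k\ge 1$ be integers, and let $\ell=k$ if $k$ is even and $\ell=k+1$ if $k$ is odd. Let $\rho$ be the maximal root of the Jacobi polynomial $P_\ell^{\frac{n-5}{2},\frac{n-5}{2}}$. Then $$N_{LP}(n,k)\ \le\ C\,k\left(\frac{1}{1-\rho^2}\right)^{\frac{n-2}{4}}\cdot\frac{P_\ell(1)}{\|P_\ell\|_2}.$$
   Context: $P_s^{\alpha,\beta}$ denotes the Jacobi polynomial of degree $s$, orthogonal on $(-1,1)$ with respect to the weight $(1-t)^\alpha(1+t)^\beta$, with the standard (Szegő) normalization $P_s^{\alpha,\beta}(1)=\binom{s+\alpha}{s}$. For an integer $n\ge 3$ put $w(t)=(1-t^2)^{\frac{n-3}{2}}$ and $P_s=P_s^{\frac{n-3}{2},\frac{n-3}{2}}$, so $P_0\equiv 1$. The norm is $\|P_s\|_2^2=\int_{-1}^1 P_s(t)^2w(t)\,dt$. The linear programming bound for spherical designs in dimension $n$ with strength $k$ is $$N_{LP}(n,k)=\sup\Big\{\frac1{a_0}:\ F=\sum_{s=0}^m a_sP_s,\ F\ge 0\text{ on }[-1,1],\ F(1)=1,\ a_s\le 0\text{ for all } s\ge k\Big\},$$ where the $a_s$ are real and the degree $m$ may be arbitrarily large. *)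

(* Defs.v *)
From mathcomp Require Import all_boot all_order all_algebra.
From mathcomp Require Import all_classical all_reals all_analysis.
From mathcomp Require Import measurable_realfun ring lra.

Set Implicit Arguments.
Unset Strict Implicit.
Unset Printing Implicit Defensive.

Import Order.TTheory GRing.Theory Num.Theory.
Import numFieldNormedType.Exports.
Local Open Scope classical_set_scope.
Local Open Scope ring_scope.

Section Jacobi.
Variable R : realType.
Implicit Types (a b t : R) (p q : {poly R}).

Definition jacobi_weight a b t : R := (1 - t) `^ a * (1 + t) `^ b.

Definition jacobi_integral a b p : R :=
  \int[lebesgue_measure]_(t in `[-1, 1]) (p.[t] * jacobi_weight a b t).

(* The generalized binomial coefficient C(s + a, s), for real a. *)
Definition binom_shift a (s : nat) : R :=
  \prod_(1 <= i < s.+1) ((a + i%:R) / i%:R).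

Definition is_jacobi a b (s : nat) p : Prop :=
  [/\ size p = s.+1,
      forall q, (size q <= s)%N -> jacobi_integral a b (p * q) = 0 &
      p.[1] = binom_shift a s].

(* P_s^(a,b) as the unique p such that is_jacobi a b s p: existence is jacobiP
   and uniqueness is is_jacobi_uniq below, for a, b >= 0. *)
Definition jacobi a b (s : nat) : {poly R} :=
  xget 0 [set p | is_jacobi a b s p].

Lemma binom_shift_gt0 a s : 0 <= a -> 0 < binom_shift a s.
Proof.
move=> a0; rewrite /binom_shift big_nat; apply: prodr_gt0 => i /andP[i0 _].
by rewrite divr_gt0 ?ltr0n// ltr_wpDl// ltr0n.
Qed.

Section nonneg.
Variables (a b : R).
Hypotheses (a0 : 0 <= a) (b0 : 0 <= b).

Let mu := @lebesgue_measure R.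
Let I : set R := `[-1, 1].
Let f p t := p.[t] * jacobi_weight a b t.
Local Notation L := (jacobi_integral a b).

Let mI : measurable (I : set (measurableTypeR R)). Proof. exact: measurable_itv. Qed.

Let muI : mu I = 2%:E.
Proof.
rewrite /mu /I lebesgue_measure_itv/= lte_fin ifT; last by rewrite gtrN.
by rewrite -EFinD opprK.
Qed.

Let measurable_f p : measurable_fun I (f p).
Proof.
apply: measurable_funM.
  apply: measurable_funTS; apply: continuous_measurable_fun.
  exact: continuous_horner.
apply: measurable_funTS.
apply: measurable_funM.
  by apply: (measurableT_comp (measurable_powR a)); exact: measurable_funB.
by apply: (measurableT_comp (measurable_powR b)); exact: measurable_funD.
Qed.

Let integrable_f p : mu.-integrable I (EFin \o f p).
Proof.
apply: measurable_bounded_integrable => //.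
- by rewrite [X in (X < _)%E]muI ltry.
- exact: measurable_f.
have /compact_bounded[M [_ HM]] : compact (horner p @` `[(-1 : R), 1]).
  apply: (@continuous_compact R R); last exact: segment_compact.
  by apply: continuous_subspaceT; exact: continuous_horner.
exists ((`|M| + 1) * (2 `^ a * 2 `^ b)); split; first exact: num_real.
move=> y Hy t It; apply/ltW/(le_lt_trans _ Hy).
have := It; rewrite /I/= in_itv/= => /andP[t1 t2].
rewrite normrM ler_pM//.
  by apply: (HM (`|M| + 1)); [rewrite ltr_pwDr// ler_norm|exists t].
rewrite /jacobi_weight ger0_norm ?mulr_ge0 ?powR_ge0// ler_pM ?powR_ge0//.
  by apply: ge0_ler_powR => //; rewrite ?nnegrE; lra.
by apply: ge0_ler_powR => //; rewrite ?nnegrE; lra.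
Qed.

Let LD p q : L (p + q) = L p + L q.
Proof.
rewrite /jacobi_integral.
rewrite -(RintegralD mI (integrable_f p) (integrable_f q)).
by apply: eq_Rintegral => t _; rewrite hornerD mulrDl.
Qed.

Let LZ c p : L (c *: p) = c * L p.
Proof.
rewrite /jacobi_integral -(RintegralZl c mI (integrable_f p)) //.
by apply: eq_Rintegral => t _; rewrite hornerZ -mulrA.
Qed.

Let LB p q : L (p - q) = L p - L q.
Proof. by rewrite LD -scaleN1r LZ mulN1r. Qed.

Lemma jacobi_integral_gt0 p : p != 0 ->
  (forall t, -1 <= t <= 1 -> 0 <= p.[t]) -> 0 < L p.
Proof.
move=> p0 pge0.
have fge0 t : I t -> 0 <= f p t.
  by rewrite /I/= in_itv/= => /pge0 ?; rewrite /f /jacobi_weight !mulr_ge0// powR_ge0.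
rewrite lt_neqAle [X in _ && X]Rintegral_ge0 ?andbT; last exact: fge0.
apply/negP => /eqP/esym L0.
have [N [mN muN IN]] : ae_eq mu I (EFin \o f p) (cst 0%E).
  apply/(ae_eq_integral_abs mu mI); first exact: measurable_int (integrable_f p).
  under eq_integral => t /set_mem It do rewrite /= ger0_norm ?fge0//.
  have := integrable_fin_num mI (integrable_f p).
  by move=> /fineK <-; congr EFin.
pose Z : set R := [set t | root (p * ('X - 1%:P) * ('X - (-1)%:P)) t].
have cZ : countable Z.
  apply: finite_set_countable; apply: contrapT => iZ.
  set r := p * _ * _ in Z iZ.
  have r0 : r != 0 by rewrite !mulf_neq0// polyXsubC_eq0.
  have [B BZ sB] := infinite_set_fset (size r) iZ.
  suff : (size (finmap.enum_fset B) < size r)%N by rewrite ltnNge sB.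
  by apply: max_poly_roots r0 _ (finmap.fset_uniq B); apply/allP => t /BZ.
have INZ : I `<=` N `|` Z.
  move=> t It; have [Zt|Zt] := pselect (Z t); first by right.
  left; apply: IN => /= /(_ It) -[]; apply/eqP.
  move: Zt; rewrite /Z/= !rootM !root_XsubC => /negP; rewrite !negb_or -!andbA.
  move=> /and3P[pt t1 t2]; move: It; rewrite /I/= in_itv/= => /andP[t3 t4].
  rewrite /f /jacobi_weight !mulf_neq0// gt_eqF// powR_gt0//.
    by rewrite subr_gt0 lt_neqAle t1.
  by rewrite -ltrBlDl sub0r lt_neqAle eq_sym t2.
have mZ : measurable Z by exact: countable_measurable.
have : (mu I <= mu (N `|` Z))%E by apply: le_measure; rewrite ?inE//; exact: measurableU.
have -> : mu (N `|` Z) = 0%E by apply: null_set_setU => //; exact: countable_lebesgue_measure0.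
by rewrite muI lee_fin lern0.
Qed.

Let LL_eq0 p : L (p * p) = 0 -> p = 0.
Proof.
move=> Lp; apply/eqP/negP => /negP p0.
suff : 0 < L (p * p) by rewrite Lp ltxx.
apply: jacobi_integral_gt0; first by rewrite mulf_neq0.
by move=> t _; rewrite hornerM -expr2 sqr_ge0.
Qed.

Lemma is_jacobi_uniq s p q : is_jacobi a b s p -> is_jacobi a b s q -> p = q.
Proof.
move=> [sp op p1] [sq oq q1].
have lq0 : lead_coef q != 0 by rewrite lead_coef_eq0 -size_poly_gt0 sq.
pose c := lead_coef p / lead_coef q; pose d := p - c *: q.
have sd : (size d <= s)%N.
  apply/leq_sizeP => j; rewrite leq_eqVlt => /predU1P[<-|sj].
    have plead : p`_s = lead_coef p by rewrite /lead_coef sp.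
    have qlead : q`_s = lead_coef q by rewrite /lead_coef sq.
    by rewrite coefB coefZ plead qlead divfK ?subrr.
  by rewrite /d coefB coefZ !nth_default ?sp ?sq// mulr0 subr0.
have d0 : d = 0.
  apply: LL_eq0; rewrite {1}/d mulrBl LB op// -scalerAl LZ oq// mulr0 subr0//.
have pq : p = c *: q by apply/eqP; rewrite -subr_eq0 -/d d0.
have := p1; rewrite pq hornerZ q1 -[RHS]mul1r.
move/(mulIf (lt0r_neq0 (binom_shift_gt0 s a0))) => ->.
by rewrite scale1r.
Qed.

Let projection n p : exists2 r : {poly R}, (size r <= n)%N &
  forall q, (size q <= n)%N -> L ((p - r) * q) = 0.
Proof.
elim: n p => [|n IHn] p.
  exists 0; first by rewrite size_poly0.
  move=> q; rewrite leqn0 size_poly_eq0 => /eqP ->.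
  by rewrite mulr0 -(scale0r 0) LZ mul0r.
have [v sv ov] := IHn 'X^n; have [r sr or] := IHn p.
pose u := 'X^n - v.
have su : size u = n.+1 by rewrite size_polyDl size_polyXn// size_polyN.
have un1 : u`_n = 1 by rewrite coefB coefXn eqxx (nth_default _ sv) subr0.
have u0 : L (u * u) != 0.
  by apply/eqP => /LL_eq0 u0; move: su; rewrite u0 size_poly0.
pose c := L ((p - r) * u) / L (u * u).
exists (r + c *: u).
  rewrite (leq_trans (size_polyD _ _))// geq_max (leq_trans sr)//=.
  by rewrite (leq_trans (size_scale_leq _ _))// su.
move=> q sq; pose q' := q - q`_n *: u.
have sq' : (size q' <= n)%N.
  apply/leq_sizeP => j; rewrite leq_eqVlt => /predU1P[<-|nj].
    by rewrite coefB coefZ un1 mulr1 subrr.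
  rewrite coefB coefZ (nth_default _ (leq_trans sq nj)).
  by rewrite (@nth_default _ _ u) ?su// mulr0 subr0.
have -> : q = q' + q`_n *: u by rewrite subrK.
have -> : (p - (r + c *: u)) * (q' + q`_n *: u) =
  (p - r) * q' + q`_n *: ((p - r) * u) - c *: (u * q' + q`_n *: (u * u)).
  by rewrite -!mul_polyC; ring.
have ou : L (u * q') = 0 by exact: ov.
rewrite LB LD !LZ LD LZ (or _ sq') ou /c !add0r.
by rewrite [X in _ - X]mulrCA divfK// subrr.
Qed.

Lemma jacobiP s : is_jacobi a b s (jacobi a b s).
Proof.
apply: xgetPex.
have [r sr or] := projection s 'X^s; pose p := 'X^s - r.
have sp : size p = s.+1 by rewrite size_polyDl size_polyXn// size_polyN.
have p1 : p.[1] != 0.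
  apply/negP => /factor_theorem[q pq].
  have q0 : q != 0 by apply/eqP => q0; move: sp; rewrite pq q0 mul0r size_poly0.
  have sq : (size q <= s)%N.
    by move: sp; rewrite pq size_Mmonic ?monicXsubC// size_XsubC addn2/= => -[->].
  have : 0 < L ((1 - 'X) * q * q).
    apply: jacobi_integral_gt0.
      by rewrite !mulf_neq0// -opprB oppr_eq0 -polyC1 polyXsubC_eq0.
    move=> t /andP[_ t1].
    rewrite -mulrA hornerM mulr_ge0//; first by rewrite !hornerE subr_ge0.
    by rewrite hornerM -expr2 sqr_ge0.
  suff -> : (1 - 'X) * q * q = (-1) *: (p * q) by rewrite LZ or// mulr0 ltxx.
  by rewrite pq scaleN1r polyC1; ring.
exists ((binom_shift a s / p.[1]) *: p); split.
- by rewrite size_scale// mulf_neq0 ?invr_eq0// gt_eqF// binom_shift_gt0.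
- by move=> q sq; rewrite -scalerAl LZ or// mulr0.
- by rewrite hornerZ divfK.
Qed.

End nonneg.
End Jacobi.

Section LinearProgram.
Variable R : realType.
Implicit Types (n k m s : nat) (t : R) (a : nat -> R).

(* These are meant for n >= 3; n%:R - 3 is the subtraction of R, not the
   truncated one. *)
Definition sphere_weight n t : R := (1 - t ^+ 2) `^ ((n%:R - 3) / 2).

Definition sphere_poly n s : {poly R} :=
  jacobi ((n%:R - 3) / 2) ((n%:R - 3) / 2) s.

Definition sphere_norm n s : R :=
  Num.sqrt (\int[lebesgue_measure]_(t in `[-1, 1])
              ((sphere_poly n s).[t] ^+ 2 * sphere_weight n t)).

Definition lp_feasible n k m a : Prop :=
  let F := \sum_(s < m.+1) a s *: sphere_poly n s in
  [/\ forall t, -1 <= t <= 1 -> 0 <= F.[t],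
      F.[1] = 1 &
      forall s, (k <= s <= m)%N -> a s <= 0].

(* The supremum is taken in the extended reals, so that an upper bound on N_LP
   includes the boundedness of the set. A feasible a has a 0 > 0 when n >= 3
   and k >= 1: F is continuous, nonnegative and F(1) = 1, and a 0 is a positive
   multiple of its weighted integral. *)
Definition N_LP n k : \bar R :=
  ereal_sup [set x | exists m a, lp_feasible n k m a /\ x = (1 / a 0%N)%:E].

Definition is_max_root (p : {poly R}) (r : R) : Prop :=
  root p r /\ forall x, root p x -> x <= r.

End LinearProgram.

Arguments sphere_poly R n s : clear implicits.
Arguments sphere_norm R n s : clear implicits.
Arguments N_LP R n k : clear implicits.

(* Main.v *)
Require Import Defs.
From mathcomp Require Import all_boot all_order all_algebra.
From mathcomp Require Import all_classical all_reals all_analysis.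
From mathcomp Require Import zify ring lra.

(* Put lam = (n - 2) / 2, w = (1 - t^2)^(lam - 1/2), y = P_l and
   L = l (l + 2 lam). By duality it suffices to find a small g with
     Q = g - (1 + t) y' + 2 L y >= 0 on [-1, 1]:
   (1 + t) y' reproduces the value at 1 on degrees < l, up to the factor
   kappa = 2 (l + lam) |y|^2 / y(1), and is orthogonal to P_s for s > l, so
   0 <= int F Q w gives kappa F(1) <= g (int w) a_0.

   Let x be the last root of y; then x <= rho. To the right of x the function
   (1 + t) y' - 2 L y is at most its value at x, because y, y', y'' are positive
   there; to the left of -x it is negative, because y is even. For |t| <= x
   Sonin's energy method, applied to u(theta) = (sin theta)^lam y(cos theta),
   bounds y and y' / L by a constant times
   sqrt lam |y| (1 - x^2)^(-lam / 2). The factor sqrt lam is absorbed by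
   int w <= 4 / sqrt lam. *)

Set Implicit Arguments.
Unset Strict Implicit.
Unset Printing Implicit Defensive.

Import Order.TTheory GRing.Theory Num.Theory.
Import numFieldNormedType.Exports.
Local Open Scope classical_set_scope.
Local Open Scope ring_scope.

(** * Integration against (1 - t^2)^a *)

(** The kernel (1 + t) y' alone is too large near 1, where it reaches 2 y'(1). Subtracting a
    multiple of y costs nothing in the duality, because the coefficient of degree l in a feasible F
    is <= 0; and L y(1) = (2 lam + 1) y'(1), the differential equation at 1, shows that 2 L y
    outweighs the kernel there.

    On |t| <= x the obstacle is uniformity in both l and lam. The quantity u^2 + u'^2 / phi is a
    good majorant of u^2 but degenerates at the turning point [t_star], where phi vanishes. The root
    x does not pass this point ([sonin_psi_last_root]), so the bound is first proved up to [t_one],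
    slightly to the left of [t_star], and then carried over the gap by the mean value theorem. For
    lam large compared with l even [t_star] is small, so its powers are kept until they cancel.

    The factor k of the theorem is L / (l + lam) <= 2 l <= 4 k, the ratio between the size of the
    kernel and kappa. *)

Section weight_calculus.
Variable R : realType.
Implicit Types (a t x y : R) (p q r : {poly R}).

Definition wpoly a q t : R := (1 - t ^+ 2) `^ a * q.[t].

(** The polynomial factor of the derivative of (1 - t^2)^a q, whose other factor is (1 - t^2)^(a -
    1). With it, integrations by parts and monotonicity arguments become polynomial identities. *)
Definition wderiv a q : {poly R} := (1 - 'X^2) * q^`() - (2 * a)%:P * 'X * q.

Lemma one_subr_sqr_gt0 t : -1 < t < 1 -> 0 < 1 - t ^+ 2.
Proof. by move=> /andP[? ?]; nra. Qed.

Lemma one_subr_sqr_ge0 t : -1 <= t <= 1 -> 0 <= 1 - t ^+ 2.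
Proof. by move=> /andP[? ?]; nra. Qed.

Lemma powR_mulrB1 a x : 0 < x -> x `^ a = x `^ (a - 1) * x.
Proof.
move=> x0; rewrite -[X in _ * X](powRr1 (ltW x0)) -powRD; first by rewrite subrK.
by rewrite (gt_eqF x0) implybT.
Qed.

Lemma is_derive_wpoly a q t : -1 < t < 1 ->
  is_derive t 1 (wpoly a q) (wpoly (a - 1) (wderiv a q) t).
Proof.
move=> t11; have t0 := one_subr_sqr_gt0 t11.
have dq : is_derive t (1 : R) (horner q) (q^`()).[t].
  split; first exact: derivable_horner.
  by rewrite -derive1E -derivE.
have df : is_derive t (1 : R) (fun t => 1 - t ^+ 2) (- (t *+ 2)).
  have -> : (fun t : R => 1 - t ^+ 2) = horner (1 - 'X^2).
    by apply/funext => z; rewrite !hornerE.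
  split; first exact: derivable_horner.
  by rewrite -derive1E -derivE derivB derivC derivXn !hornerE.
have dg := is_derive1_powR a t0.
have dh : is_derive t (1 : R) ((fun x : R => x `^ a) \o (fun t => 1 - t ^+ 2))
    (a * (1 - t ^+ 2) `^ (a - 1) * - (t *+ 2)).
  exact: is_derive1_comp.
apply: (is_derive_eq (is_deriveM dh dq)).
rewrite -[_ *: (_ * _ : R)]/(_ * _) -[_ *: q^`().[t]]/(_ * _) /wpoly /wderiv !hornerE /=.
rewrite (powR_mulrB1 a t0).
by rewrite mulr2n; ring.
Qed.

Let cvg_weight a t (F : set_system R) {FF : Filter F} : 0 < a -> F --> t ->
  1 - t ^+ 2 = 0 -> (\forall x \near F, 0 < 1 - x ^+ 2) ->
  ((1 - x ^+ 2) `^ a) @[x --> F] --> (1 - t ^+ 2) `^ a.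
Proof.
move=> a0 Ft t0 F0; rewrite t0 powR0 ?gt_eqF//.
apply: (@cvg_comp _ _ _ (fun x => 1 - x ^+ 2) (fun x : R => x `^ a) _ (0 : R)^'+); last exact: powR_cvg0.
have c : (1 - x ^+ 2) @[x --> F] --> (0 : R).
  rewrite -t0; apply: cvgB; first exact: cvg_cst.
  exact: (@cvg_comp _ _ _ id (fun x : R => x ^+ 2) _ _ _ Ft (@exprn_continuous R 2 t)).
move=> P /c; rewrite /nbhs/= => cP.
by apply: filterS2 F0 cP => x x0; apply.
Qed.

Lemma wpoly_LR a q : 0 < a -> derivable_oo_LRcontinuous (wpoly a q) (-1) 1.
Proof.
move=> a0; split.
- move=> t; rewrite in_itv/= => t11.
  exact: (@ex_derive _ _ _ _ _ _ _ (is_derive_wpoly a q t11)).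
- apply: cvgM; last by apply: cvg_at_right_filter; exact: continuous_horner.
  apply: cvg_weight => //; [exact: cvg_at_right_filter|by rewrite sqrrN expr1n subrr|].
  near=> x; apply: one_subr_sqr_gt0; apply/andP; split => //.
- apply: cvgM; last by apply: cvg_at_left_filter; exact: continuous_horner.
  apply: cvg_weight => //; [exact: cvg_at_left_filter|by rewrite expr1n subrr|].
  near=> x; apply: one_subr_sqr_gt0; apply/andP; split => //.
Unshelve. all: by end_near. Qed.

Lemma wpoly_continuous a q : 0 < a -> {within `[-1, 1], continuous (wpoly a q)}.
Proof. by move=> /wpoly_LR/derivable_oo_LRcontinuous_within. Qed.

Lemma wpoly_nincr a q x y : 0 < a -> -1 <= x -> x <= y -> y <= 1 ->
  (forall t, x < t < y -> (wderiv a q).[t] <= 0) -> wpoly a q y <= wpoly a q x.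
Proof.
move=> a0 x1 xy y1 H.
have sub : `]x, y[ `<=` `]-1, 1[.
  by move=> t/=; rewrite !in_itv/= => /andP[? ?]; apply/andP; split; lra.
apply: (@ler0_derive1_le_cc _ (wpoly a q) x y) => //.
- by move=> t /sub/=; rewrite in_itv/= => /(is_derive_wpoly a q)/(@ex_derive _ _ _ _ _ _ _).
- move=> t txy; have := sub _ txy; rewrite /= in_itv/= => /(is_derive_wpoly a q)[_].
  rewrite -derive1E => ->; rewrite /wpoly mulr_ge0_le0 ?powR_ge0//.
  by apply: H; move: txy; rewrite in_itv.
- apply: (continuous_subspaceW _ (wpoly_continuous a0)).
  by move=> t/=; rewrite !in_itv/= => /andP[? ?]; apply/andP; split; lra.
- by rewrite in_itv/= lexx xy.
- by rewrite in_itv/= lexx.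
Qed.

Lemma wpoly_mean_value a q x y : 0 < a -> -1 <= x -> x < y -> y <= 1 ->
  exists2 t, x < t < y & wpoly a q y - wpoly a q x = wpoly (a - 1) (wderiv a q) t * (y - x).
Proof.
move=> a0 x1 xy y1.
have dw t : t \in `]x, y[ -> is_derive t (1 : R) (wpoly a q) (wpoly (a - 1) (wderiv a q) t).
  by rewrite in_itv/= => /andP[? ?]; apply: is_derive_wpoly; apply/andP; split; lra.
have cw : {within `[x, y], continuous (wpoly a q)}.
  apply: (continuous_subspaceW _ (wpoly_continuous a0)).
  by move=> t/=; rewrite !in_itv/= => /andP[? ?]; apply/andP; split; lra.
have [t] := MVT xy dw cw.
by rewrite in_itv => txy E; exists t.
Qed.

End weight_calculus.

Section jacobi_functional.
Variables (R : realType) (a : R).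
Hypothesis a0 : 0 < a.
Implicit Types (p q : {poly R}) (c t x y : R).

Let mu := @lebesgue_measure R.
Let I : set R := `[-1, 1].
Let mI : measurable (I : set (measurableTypeR R)). Proof. exact: measurable_itv. Qed.

Local Notation L := (jacobi_integral a a).

Lemma jacobi_weightE t : -1 <= t <= 1 -> jacobi_weight a a t = (1 - t ^+ 2) `^ a.
Proof.
move=> /andP[t0 t1]; rewrite /jacobi_weight -powRM; [|lra|lra].
by congr (_ `^ _); ring.
Qed.

Lemma jacobi_integralE p :
  L p = \int[lebesgue_measure]_(t in `[-1, 1]) wpoly a p t.
Proof.
apply: eq_Rintegral => t /set_mem/=; rewrite in_itv/= => t11.
by rewrite jacobi_weightE// mulrC.
Qed.

Let integrable_wpoly p : mu.-integrable I (EFin \o wpoly a p).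
Proof.
by apply: continuous_compact_integrable; [exact: segment_compact|exact: wpoly_continuous].
Qed.

Lemma jacobi_integralD p q : L (p + q) = L p + L q.
Proof.
rewrite !jacobi_integralE -(RintegralD mI (integrable_wpoly p) (integrable_wpoly q)).
by apply: eq_Rintegral => t _; rewrite /wpoly hornerD mulrDr.
Qed.

Lemma jacobi_integralZ c p : L (c *: p) = c * L p.
Proof.
rewrite !jacobi_integralE -(RintegralZl c mI (integrable_wpoly p)).
by apply: eq_Rintegral => t _; rewrite /wpoly hornerZ mulrCA.
Qed.

Lemma jacobi_integralN p : L (- p) = - L p.
Proof. by rewrite -scaleN1r jacobi_integralZ mulN1r. Qed.

Lemma jacobi_integralB p q : L (p - q) = L p - L q.
Proof. by rewrite jacobi_integralD jacobi_integralN. Qed.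

Lemma jacobi_integral0 : L 0 = 0.
Proof. by rewrite -(scale0r 0) jacobi_integralZ mul0r. Qed.

Lemma jacobi_integral_sum n (f : nat -> {poly R}) :
  L (\sum_(i < n) f i) = \sum_(i < n) L (f i).
Proof.
elim: n => [|n IHn]; first by rewrite !big_ord0 jacobi_integral0.
by rewrite !big_ord_recr/= jacobi_integralD IHn.
Qed.

Lemma ler_jacobi_integral p q : (forall t, -1 <= t <= 1 -> p.[t] <= q.[t]) -> L p <= L q.
Proof.
move=> pq; rewrite !jacobi_integralE; apply: le_Rintegral => // t/=.
by rewrite in_itv/= => /pq ?; rewrite /wpoly ler_wpM2l ?powR_ge0.
Qed.

(** A Chebyshev-type estimate. It serves with c > 0 or c = 0 for the energy and with c = -1 for the
    mass of the weight. *)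
Lemma jacobi_integral_ge_itv p c x y : -1 <= x -> x <= y -> y <= 1 ->
  (forall t, -1 <= t <= 1 -> (if x <= t <= y then c else 0) <= wpoly a p t) ->
  c * (y - x) <= L p.
Proof.
move=> x1 xy y1 H; rewrite jacobi_integralE.
pose f (t : R) : R := c * \1_`[x, y] t.
have sxy : `[x, y] `<=` I.
  by move=> t/=; rewrite /I/= !in_itv/= => /andP[? ?]; apply/andP; split; lra.
have mxy : measurable (`[x, y] : set (measurableTypeR R)) by exact: measurable_itv.
have muxy : mu `[x, y] = (y - x)%:E.
  rewrite /mu lebesgue_measure_itv/= lte_fin; case: ltP => [_|yx].
    by rewrite -EFinD.
  by have -> : y = x; [apply/le_anti; rewrite xy yx|rewrite subrr].
have i1 : mu.-integrable I (EFin \o \1_`[x, y]).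
  have := @integrable_indic_itv R x y true false.
  by apply: integrableS => //; exact: subsetT.
have if_ : mu.-integrable I (EFin \o f).
  have := integrableZl mI c i1; apply: eq_integrable => // t _.
have -> : c * (y - x) = \int[mu]_(t in I) f t.
  rewrite /f RintegralZl//; congr (c * _).
  by rewrite /Rintegral integral_indic// setIidl// [X in fine X]muxy.
apply: le_Rintegral => // t; rewrite /I/= in_itv/= => It.
apply: le_trans (H _ It); rewrite /f indicE.
rewrite (_ : (t \in _) = (x <= t <= y)); last by rewrite mem_setE in_itv.
by case: ifP => _; rewrite ?mulr1 ?mulr0.
Qed.

(** The integrand is the derivative of (1 - t^2)^(a + 1) q, which vanishes at both ends. Every
    integration by parts below is this identity for a suitable q. *)
Lemma jacobi_integral_ibp q : L (wderiv (a + 1) q) = 0.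
Proof.
have a1 : 0 < a + 1 by rewrite addr_gt0.
rewrite /jacobi_integral /Rintegral.
under eq_integral => t.
  move=> /set_mem/=; rewrite in_itv/= => t11.
  rewrite jacobi_weightE// mulrC -/(wpoly a (wderiv (a + 1) q) t).
  over.
rewrite (@continuous_FTC2 _ _ (wpoly (a + 1) q)).
- by rewrite /wpoly sqrrN expr1n subrr powR0 ?gt_eqF// !mul0r -EFinD subrr.
- by rewrite gtrN.
- exact: wpoly_continuous.
- exact: wpoly_LR.
- move=> t; rewrite in_itv/= => /(is_derive_wpoly (a + 1) q)[_].
  by rewrite addrK derive1E.
Qed.

End jacobi_functional.

(** * The Gegenbauer equation and the roots *)

Section real_poly.
Variable R : realType.
Implicit Types (p q r : {poly R}) (x z t : R).

(** Any root in (a, x] is also a root of the quotient of p by 'X - a, so moving to it lowers the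
    size and the search ends. *)
Lemma last_root p a x : p != 0 -> root p a -> a <= x ->
  exists z, [/\ a <= z <= x, root p z & forall t, z < t <= x -> ~~ root p t].
Proof.
move: {2}(size p) (leqnn (size p)) => n.
elim: n p a => [|n IHn] p a; first by rewrite leqn0 size_poly_eq0 => /eqP ->; rewrite eqxx.
move=> sp p0 pa ax.
have [[t /andP[at_ tx] pt]|np] := pselect (exists2 t, a < t <= x & root p t); last first.
  exists a; split; rewrite ?lexx// => t tx; apply/negP => pt; apply: np.
  by exists t.
have [q pq] := factor_theorem _ _ pa.
have q0 : q != 0 by apply: contra_neq p0 => q0; rewrite pq q0 mul0r.
have sq : (size q <= n)%N.
  by move: sp; rewrite pq size_Mmonic ?monicXsubC// size_XsubC addn2.
have qt : root q t.
  by move: pt; rewrite pq rootM root_XsubC => /orP[//|/eqP ta]; rewrite ta ltxx in at_.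
have [z [/andP[tz zx] qz zlast]] := IHn q t sq q0 qt tx.
exists z; split.
- by rewrite (le_trans (ltW at_) tz) zx.
- by rewrite pq rootM qz.
- move=> s /andP[zs sx]; rewrite pq rootM root_XsubC negb_or zlast ?zs//=.
  by rewrite gt_eqF// (lt_le_trans at_)// (le_trans tz (ltW zs)).
Qed.

Lemma ivt_root p x z : x <= z -> p.[x] <= 0 -> 0 <= p.[z] ->
  exists2 t, x <= t <= z & root p t.
Proof. by move=> xz px pz; apply: poly_ivt => //; rewrite px pz. Qed.

Lemma poly_ge0_left p x z : x < z ->
  (forall t, x < t <= z -> 0 < p.[t]) -> 0 <= p.[x].
Proof.
move=> xz ppos; rewrite leNgt; apply/negP => px.
have pz : 0 < p.[z] by apply: ppos; rewrite xz lexx.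
have [t /andP[xt tz] /eqP pt] := ivt_root (ltW xz) (ltW px) (ltW pz).
move: xt; rewrite le_eqVlt => /predU1P[xt|xt]; first by rewrite xt pt ltxx in px.
by have := ppos t; rewrite xt tz pt ltxx => /(_ isT).
Qed.

Lemma poly_pos_sign p x z : (forall t, x < t <= z -> ~~ root p t) -> 0 < p.[z] ->
  forall t, x < t <= z -> 0 < p.[t].
Proof.
move=> npr pz t /andP[xt tz]; rewrite ltNge; apply/negP => pt.
have [s /andP[ts sz]] := ivt_root tz pt (ltW pz).
by apply/negP/npr; rewrite (lt_le_trans xt ts) sz.
Qed.

Lemma horner_factor_deriv q z : (q * ('X - z%:P))^`().[z] = q.[z].
Proof. by rewrite derivM derivXsubC mulr1 hornerD hornerM hornerXsubC subrr mulr0 add0r. Qed.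

(* At the last root z of p' the factorization p' = ('X - z) q gives
   p''(z) = q(z) >= 0, while the differential equation gives p''(z) < 0. *)
Lemma deriv_gt0_of_ode p (c k x : R) : -1 <= x -> x < 1 -> 0 < c -> 0 < k ->
  (forall t, (1 - t ^+ 2) * p^`()^`().[t] = c * t * p^`().[t] - k * p.[t]) ->
  (forall t, x < t <= 1 -> 0 < p.[t]) -> forall t, x < t <= 1 -> 0 < p^`().[t].
Proof.
move=> x0 x1 c0 k0 ode ppos.
have p1 : 0 < p.[1] by apply: ppos; rewrite x1 lexx.
have dp1 : 0 < p^`().[1].
  have := ode 1; rewrite expr1n subrr mul0r mulr1 => /esym/eqP.
  by rewrite subr_eq0 => /eqP E; rewrite -(pmulr_rgt0 _ c0) E mulr_gt0.
have dp0 : p^`() != 0 by apply: contraTneq dp1 => ->; rewrite horner0 ltxx.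
apply: (poly_pos_sign _ dp1) => s /andP[xs s1]; apply/negP => rs.
have [z [/andP[sz z1] rz zlast]] := last_root dp0 rs s1.
have {}z1 : z < 1.
  by rewrite lt_neqAle z1 andbT; apply/eqP => E; move: rz; rewrite E /root gt_eqF.
have [q dpq] := factor_theorem _ _ rz.
have qz : 0 <= q.[z].
  apply: (poly_ge0_left z1) => t /andP[zt t1].
  have : 0 < p^`().[t] by apply: (poly_pos_sign zlast dp1); rewrite zt t1.
  by rewrite dpq hornerM hornerXsubC pmulr_lgt0// subr_gt0.
have := ode z; rewrite {1}dpq horner_factor_deriv (eqP rz) mulr0 sub0r => E.
have pz : 0 < p.[z] by apply: ppos; rewrite (lt_le_trans xs sz) ltW.
have : 0 < k * p.[z] by exact: mulr_gt0.
suff : 0 <= (1 - z ^+ 2) * q.[z] by lra.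
by rewrite mulr_ge0// one_subr_sqr_ge0// (ltW z1) andbT; lra.
Qed.

End real_poly.

Section gegenbauer.
Variables (R : realType) (a : R).
Hypothesis a0 : 0 < a.
Implicit Types (p q r : {poly R}) (t x c : R) (i l n : nat).

Local Notation J := (jacobi_integral a a).

(** The Gegenbauer operator (1 - t^2) p'' - (2 a + 2) t p'. This self-adjoint form makes its
    symmetry an integration by parts. *)
Definition gegen_op p : {poly R} := wderiv (a + 1) p^`().

Definition gegen_eigen n : R := n%:R * (n%:R + 2 * a + 1).

Lemma jacobi_integral_sqr_eq0 p : J (p * p) = 0 -> p = 0.
Proof.
move=> Jp; apply/eqP/negP => /negP p0.
suff : 0 < J (p * p) by rewrite Jp ltxx.
apply: jacobi_integral_gt0; rewrite ?ltW ?mulf_neq0//.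
by move=> t _; rewrite hornerM -expr2 sqr_ge0.
Qed.

Lemma jacobi_integral_gegen_op p q :
  J (gegen_op p * q) = - J ((1 - 'X^2) * p^`() * q^`()).
Proof.
apply/eqP; rewrite -subr_eq0 opprK -(jacobi_integralD a0) -(jacobi_integral_ibp a0 (p^`() * q)).
by apply/eqP; congr J; rewrite /gegen_op /wderiv derivM; ring.
Qed.

Lemma gegen_op_sym p q : J (gegen_op p * q) = J (p * gegen_op q).
Proof.
rewrite jacobi_integral_gegen_op (mulrC p) jacobi_integral_gegen_op.
by congr (- J _); ring.
Qed.

Lemma coef_gegen_op p i :
  (gegen_op p)`_i = (i%:R + 2) * (i%:R + 1) * p`_i.+2 - gegen_eigen i * p`_i.
Proof.
rewrite /gegen_op /wderiv /gegen_eigen mulrBl mul1r -mulrA !coefB coefCM coefXM coefXnM.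
case: i => [|[|i]] /=; rewrite !coef_deriv ?subn2/=.
- by ring.
- by ring.
- by ring.
Qed.

Lemma size_gegen_op p n : (size p <= n)%N -> (size (gegen_op p) <= n)%N.
Proof.
move=> /leq_sizeP sp; apply/leq_sizeP => i ni; rewrite coef_gegen_op !sp ?mulr0 ?subrr//.
by lia.
Qed.

Lemma gegen_eigen_inj i l : (i < l)%N -> gegen_eigen i < gegen_eigen l.
Proof.
rewrite /gegen_eigen -(ltr_nat R) => il; have i0 : 0 <= i%:R :> R by [].
have a0' := a0; move: (i%:R) (l%:R) i0 il => x z x0 xz.
suff : 0 < (z - x) * (z + x + 2 * a + 1) by lra.
by rewrite mulr_gt0 ?subr_gt0//; lra.
Qed.

(** The operator is triangular in the monomials, with eigenvalues -[gegen_eigen] that are pairwise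
    distinct: a leading term of degree d < l cannot have the eigenvalue of degree l. *)
Lemma gegen_ode_uniq l p : (size p <= l)%N ->
  gegen_op p = - gegen_eigen l *: p -> p = 0.
Proof.
move=> sp E; apply/eqP; rewrite -size_poly_eq0; case s : (size p) => [//|d].
have := congr1 (fun q => q`_d) E; rewrite coef_gegen_op coefZ.
rewrite (@nth_default _ _ p d.+2) ?s// mulr0 sub0r => {}E.
have /eqP : (gegen_eigen l - gegen_eigen d) * p`_d = 0 by lra.
rewrite mulf_eq0 => /orP[|].
  by rewrite subr_eq0 gt_eqF// gegen_eigen_inj// -s.
by rewrite -[d]/d.+1.-1 -s -/(lead_coef p) lead_coef_eq0 => /eqP p0; rewrite p0 size_poly0 in s.
Qed.

Section orthogonal.
Variables (l : nat) (y : {poly R}).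
Hypotheses (sy : size y = l.+1).
Hypothesis oy : forall q, (size q <= l)%N -> J (y * q) = 0.

Lemma orth_neq0 : y != 0. Proof. by rewrite -size_poly_eq0 sy. Qed.

(** In [gegen_op] y + [gegen_eigen] l y the terms of degree l cancel. By symmetry and the
    orthogonality of y, this remainder is orthogonal to every polynomial of degree < l, itself
    included. *)
Lemma gegen_ode : gegen_op y = - gegen_eigen l *: y.
Proof.
apply/eqP; rewrite scaleNr -addr_eq0; apply/eqP.
set z := _ + _; have sz : (size z <= l)%N.
  apply/leq_sizeP => i li; rewrite coefD coefZ coef_gegen_op.
  rewrite (@nth_default _ _ y i.+2) ?sy; last by lia.
  move: li; rewrite leq_eqVlt => /predU1P[->|li]; first by ring.
  by rewrite (@nth_default _ _ y i) ?sy//; ring.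
apply: jacobi_integral_sqr_eq0.
rewrite {1}/z mulrDl -scalerAl (jacobi_integralD a0) (jacobi_integralZ a0).
by rewrite gegen_op_sym !oy// ?mulr0 ?addr0// size_gegen_op.
Qed.

Lemma gegen_ode_horner t :
  (1 - t ^+ 2) * y^`()^`().[t] = (2 * a + 2) * t * y^`().[t] - gegen_eigen l * y.[t].
Proof.
have E : (gegen_op y).[t] = (- gegen_eigen l *: y).[t] by rewrite gegen_ode.
by rewrite /gegen_op /wderiv !hornerE in E; lra.
Qed.

Lemma gegen_ode_deriv_horner t :
  (1 - t ^+ 2) * y^`()^`()^`().[t] =
  (2 * a + 4) * t * y^`()^`().[t] - (gegen_eigen l - (2 * a + 2)) * y^`().[t].
Proof.
have E : (gegen_op y)^`().[t] = (- gegen_eigen l *: y)^`().[t] by rewrite gegen_ode.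
by rewrite /gegen_op /wderiv !poly.derivE !hornerE in E; lra.
Qed.

(** A root x >= 1 would give y q = -(x - t) q^2, of constant sign on [-1, 1], with q of degree <
    l. *)
Lemma orth_root_lt1 x : root y x -> x < 1.
Proof.
move=> /factor_theorem[q yq]; rewrite ltNge; apply/negP => x1.
have q0 : q != 0 by apply: contraNneq orth_neq0 => q0; rewrite yq q0 mul0r.
have sq : (size q <= l)%N.
  by move: sy; rewrite yq size_Mmonic ?monicXsubC// size_XsubC addn2/= => -[->].
have : 0 < J ((x%:P - 'X) * q * q).
  apply: jacobi_integral_gt0; rewrite ?ltW ?mulf_neq0//.
    by rewrite -opprB oppr_eq0 polyXsubC_eq0.
  move=> t /andP[_ t1]; rewrite -mulrA hornerM mulr_ge0//.
    by rewrite !hornerE subr_ge0 (le_trans t1 x1).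
  by rewrite hornerM -expr2 sqr_ge0.
rewrite (_ : _ * q * q = - (y * q)); last by rewrite yq; ring.
by rewrite (jacobi_integralN a0) oy// oppr0 ltxx.
Qed.

Lemma orth_simple_root x : root y x -> y^`().[x] != 0.
Proof.
move=> /factor_theorem[q yq]; rewrite {1}yq horner_factor_deriv.
apply/negP => /factor_theorem[r qr].
have r0 : r != 0 by apply: contraNneq orth_neq0 => r0; rewrite yq qr r0 !mul0r.
have sr : (size r <= l)%N.
  have q0 : q != 0 by apply: contraNneq orth_neq0 => q0; rewrite yq q0 mul0r.
  move: sy; rewrite yq size_Mmonic ?monicXsubC// size_XsubC addn2/= => -[<-].
  by rewrite qr size_Mmonic ?monicXsubC// size_XsubC addn2/=.
have : 0 < J (('X - x%:P) * r * (('X - x%:P) * r)).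
  apply: jacobi_integral_gt0; rewrite ?ltW ?mulf_neq0 ?polyXsubC_eq0//.
  by move=> t _; rewrite hornerM -expr2 sqr_ge0.
rewrite (_ : _ * r * _ = y * r); last by rewrite yq qr; ring.
by rewrite oy// ltxx.
Qed.

Lemma orth_root_exists : (0 < l)%N -> 0 < y.[1] -> exists2 x, -1 <= x & root y x.
Proof.
move=> l0 y1.
have [//|nr] := pselect (exists2 x, -1 <= x & root y x).
have y1' : 0 < y.[-1].
  have m11 : (-1 : R) <= 1 by lra.
  rewrite ltNge; apply/negP => ym1.
  have [t /andP[t1 _] rt] := ivt_root m11 ym1 (ltW y1).
  by apply: nr; exists t.
suff : 0 < J (y * 1) by rewrite oy ?ltxx// size_poly1.
rewrite mulr1; apply: jacobi_integral_gt0; rewrite ?ltW ?orth_neq0// => t /andP[t0 t1].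
rewrite leNgt; apply/negP => yt.
have [s /andP[ts _] rs] := ivt_root t1 (ltW yt) (ltW y1).
by apply: nr; exists s => //; exact: le_trans t0 ts.
Qed.

(** The operator respects parity, so the odd part of y solves the same equation; for even l it has
    degree < l, hence is 0. *)
Lemma orth_odd_coef i : ~~ odd l -> odd i -> y`_i = 0.
Proof.
move=> el oi; pose o := \poly_(i < l.+1) (if odd i then y`_i else 0).
have coo j : o`_j = if odd j then y`_j else 0.
  by rewrite coef_poly ltnS; case: leqP => // lj; rewrite nth_default ?sy ?if_same.
suff o0 : o = 0 by have := coo i; rewrite o0 coef0 oi.
apply: (@gegen_ode_uniq l).
  apply/leq_sizeP => j; rewrite coo leq_eqVlt => /predU1P[<-|lj]; first by rewrite (negbTE el).
  by rewrite nth_default ?sy ?if_same.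
apply/polyP => j; rewrite coef_gegen_op coefZ !coo /= negbK.
case: ifP => _; last by rewrite !mulr0 subr0.
by rewrite -coef_gegen_op gegen_ode coefZ.
Qed.

Lemma orth_evenE : ~~ odd l -> y = even_poly y \Po 'X^2.
Proof.
move=> el; rewrite -[LHS]poly_even_odd (_ : odd_poly y = 0) ?comp_poly0 ?mul0r ?addr0//.
apply/polyP => i; rewrite coef_odd_poly coef0 orth_odd_coef//=.
by rewrite odd_double.
Qed.

Lemma orth_hornerN t : ~~ odd l -> y.[- t] = y.[t].
Proof. by move=> /orth_evenE ->; rewrite !horner_comp !hornerXn sqrrN. Qed.

Lemma orth_derivN t : ~~ odd l -> y^`().[- t] = - y^`().[t].
Proof.
move=> /orth_evenE ->; rewrite deriv_comp derivXn !hornerM !horner_comp !hornerMn !hornerXn.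
by rewrite sqrrN !expr1 mulNrn mulrN.
Qed.

End orthogonal.
End gegenbauer.

(** * The reproducing kernel at 1 *)

Section wderiv_algebra.
Variable R : realType.
Implicit Types (c : R) (p q : {poly R}).

Lemma coef_wderivS c p n :
  (wderiv c p)`_n.+1 = (n%:R + 2) * p`_n.+2 - (n%:R + 2 * c) * p`_n.
Proof.
rewrite /wderiv mulrBl mul1r -mulrA !coefB coefCM coefXM coefXnM.
by case: n => [|n] /=; rewrite !coef_deriv ?subn2/=; ring.
Qed.

Lemma size_wderiv c p n : (size p <= n)%N -> (size (wderiv c p) <= n.+1)%N.
Proof.
move=> /leq_sizeP sp; apply/leq_sizeP => -[//|i] ni.
by rewrite coef_wderivS !sp ?mulr0 ?subrr//; lia.
Qed.

Lemma size_mulXaddC_deriv c p n : (size p <= n)%N -> (size (('X + c%:P) * p^`())%R <= n)%N.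
Proof.
move=> /leq_sizeP sp; apply/leq_sizeP => -[|i] ni.
  by rewrite mulrDl coefD coefXM coefCM coef_deriv/= sp ?mul0rn ?mulr0 ?addr0//; lia.
by rewrite mulrDl coefD coefXM coefCM !coef_deriv/= !sp ?mul0rn ?mulr0 ?addr0//; lia.
Qed.

End wderiv_algebra.

Section orthogonal_facts.
Variables (R : realType) (a : R).
Hypothesis a0 : 0 < a.
Implicit Types (p q r : {poly R}) (t : R).
Variables (l : nat) (y : {poly R}).
Hypotheses (sy : size y = l.+1).
Local Notation J := (jacobi_integral a a).
Hypothesis oy : forall q, (size q <= l)%N -> J (y * q) = 0.

Lemma orth_lead_coef : lead_coef y = y`_l. Proof. by rewrite /lead_coef sy. Qed.

Lemma orth_lead_neq0 : y`_l != 0.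
Proof. by rewrite -orth_lead_coef lead_coef_eq0 -size_poly_gt0 sy. Qed.

Lemma size_orth_reduce p : (size p <= l.+1)%N -> (size (y`_l *: p - p`_l *: y)%R <= l)%N.
Proof.
move=> sp; apply/leq_sizeP => i; rewrite leq_eqVlt => /predU1P[<-|li].
  by rewrite coefB !coefZ mulrC subrr.
have yi : y`_i = 0 by rewrite nth_default// sy.
have pi : p`_i = 0 by rewrite nth_default// (leq_trans sp).
by rewrite coefB !coefZ yi pi !mulr0 subrr.
Qed.

Lemma orth_top p : (size p <= l.+1)%N -> y`_l * J (y * p) = p`_l * J (y * y).
Proof.
move=> /size_orth_reduce/oy; rewrite mulrBr -!scalerAr.
by rewrite (jacobi_integralB a0) !(jacobi_integralZ a0) => /eqP; rewrite subr_eq0 => /eqP.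
Qed.

Lemma orth_proportional p : (size p <= l.+1)%N ->
  (forall q, (size q <= l)%N -> J (p * q) = 0) -> y`_l *: p = p`_l *: y.
Proof.
move=> sp op; have sd := size_orth_reduce sp.
apply/eqP; rewrite -subr_eq0; apply/eqP; apply: (jacobi_integral_sqr_eq0 a0).
by rewrite {1}mulrBl -!scalerAl (jacobi_integralB a0) !(jacobi_integralZ a0) op// oy// !mulr0 subrr.
Qed.

Lemma jacobi_integral_deriv_move r :
  J ((1 - 'X^2) * y^`() * r) = - J (y * wderiv (a + 1) r).
Proof.
apply/eqP; rewrite -subr_eq0 opprK -(jacobi_integralD a0) -(jacobi_integral_ibp a0 (y * r)).
by apply/eqP; congr J; rewrite /wderiv derivM; ring.
Qed.

(** Up to a factor, the sum of P_s(1) P_s / |P_s|^2 over s < l plus a multiple of y. *)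
Definition dual_kernel : {poly R} := ('X + 1%:P) * y^`().

Lemma size_dual_kernel : (size dual_kernel <= l.+1)%N.
Proof. by rewrite size_mulXaddC_deriv// sy. Qed.

Lemma dual_kernel_split q r : q = r * ('X - 1%:P) + (q.[1])%:P ->
  J (dual_kernel * q) = q.[1] * J dual_kernel + J (y * wderiv (a + 1) r).
Proof.
move=> E; rewrite -[J (y * _)]opprK -jacobi_integral_deriv_move.
rewrite -(jacobi_integralN a0) -(jacobi_integralZ a0) -(jacobi_integralD a0).
by congr J; rewrite {1}E /dual_kernel -mul_polyC; ring.
Qed.

Lemma split_at1 q : exists2 r, q = r * ('X - 1%:P) + (q.[1])%:P & size r = (size q).-1.
Proof.
have [r E] : exists r, q - (q.[1])%:P = r * ('X - 1%:P).
  by apply/factor_theorem; rewrite /root !hornerE subrr.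
have E' : q = r * ('X - 1%:P) + (q.[1])%:P by rewrite -E subrK.
exists r => //; have [r0|r0] := eqVneq r 0.
  by rewrite E' r0 mul0r add0r size_poly0 size_polyC; case: eqP.
rewrite E' size_polyDl size_Mmonic ?monicXsubC// size_XsubC addn2//=.
by rewrite size_polyC; case: eqP => //= _; rewrite ltnS size_poly_gt0.
Qed.

(* Writing q = q(1) + ('X - 1) r turns (1 + 'X) y' q into -(1 - 'X^2) y' r up
   to the value at 1, and integration by parts then meets the orthogonality. *)
Lemma dual_kernel_reproducing q : (size q <= l)%N ->
  J (dual_kernel * q) = q.[1] * J dual_kernel.
Proof.
move=> sq; have [r E sr] := split_at1 q.
rewrite (dual_kernel_split E) oy ?addr0//.
case: (posnP (size r)) => [/eqP|r0].
  by rewrite size_poly_eq0 => /eqP ->; rewrite /wderiv derivC !mulr0 subrr size_poly0.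
by have := size_wderiv (a + 1) (leqnn (size r)); move: r0; rewrite sr; lia.
Qed.

(** By [orth_top] only the coefficient of degree l counts, and that of (1 + t) y' is l times that of
    y. *)
Lemma dual_kernel_self : J (dual_kernel * y) = l%:R * J (y * y).
Proof.
have := orth_top size_dual_kernel; rewrite mulrC => E.
have : (dual_kernel)`_l = l%:R * y`_l.
  rewrite /dual_kernel mulrDl mul1r coefD coefXM (coef_deriv _ l).
  rewrite (nth_default 0 (_ : (size y <= l.+1)%N)) ?sy// mul0rn addr0.
  by case: (l) => [|n] /=; rewrite ?mul0r// coef_deriv mulr_natl.
move=> cl; apply: (mulIf orth_lead_neq0).
by rewrite (mulrC dual_kernel) E cl; ring.
Qed.

(** The splitting at 1 is applied to q = y itself. The last term then sees only the top coefficient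
    of [wderiv] (a + 1) r, which is -(l - 1 + 2 (a + 1)) y_l; together with the l of
    [dual_kernel_self] this gives 2 l + 2 a + 1. *)
Lemma dual_kernel_mass : (0 < l)%N ->
  y.[1] * J dual_kernel = (2 * l%:R + 2 * a + 1) * J (y * y).
Proof.
move=> l0; have [r E] := split_at1 y; rewrite sy/= => sr.
have rl : r`_l.-1 = y`_l.
  have -> : y`_l = (r * ('X - 1%:P) + (y.[1])%:P)`_l by rewrite -E.
  rewrite polyC1 mulrBr mulr1 coefD coefB coefMX coefC (gtn_eqF l0).
  by rewrite (nth_default 0 (_ : (size r <= l)%N)) ?sr// subr0 addr0.
have := dual_kernel_split E; rewrite dual_kernel_self.
have sw : (size (wderiv (a + 1) r) <= l.+1)%N by rewrite size_wderiv ?sr.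
have := orth_top sw.
rewrite -{2}(prednK l0) coef_wderivS rl (nth_default 0 (_ : (size r <= l.-1.+2)%N)); last first.
  by rewrite sr; lia.
have -> : l.-1%:R = l%:R - 1 :> R by rewrite -{2}(prednK l0) -natr1 addrK.
rewrite mulr0 sub0r => Ew.
have {}Ew : J (y * wderiv (a + 1) r) = - (l%:R - 1 + 2 * (a + 1)) * J (y * y).
  by apply: (mulfI orth_lead_neq0); rewrite Ew; ring.
by rewrite Ew => E2; lra.
Qed.

Lemma orth_top_eq0 p : (l.+1 < size p)%N ->
  (forall q, (size q <= (size p).-1)%N -> J (p * q) = 0) ->
  J (p * y) = 0 /\ J (p * dual_kernel) = 0.
Proof.
by move=> lp op; split; apply: op; rewrite ?sy ?(leq_trans size_dual_kernel); lia.
Qed.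

End orthogonal_facts.

(** * Comparison of the last root of y with rho *)

Section lower_weight.
Variables (R : realType) (b : R).
Hypothesis b1 : 0 < b - 1.
Implicit Types (p q r : {poly R}) (t : R).
Variables (l : nat) (y v : {poly R}).
Hypotheses (el : ~~ odd l) (l2 : (2 <= l)%N).
Hypotheses (sy : size y = l.+1) (sv : size v = l.+1).
Local Notation J := (jacobi_integral b b).
Local Notation J' := (jacobi_integral (b - 1) (b - 1)).
Hypothesis oy : forall q, (size q <= l)%N -> J (y * q) = 0.
Hypothesis ov : forall q, (size q <= l)%N -> J' (v * q) = 0.
Hypothesis y1 : 0 < y.[1].

Let b0 : 0 < b. Proof. by have := b1; lra. Qed.

Lemma jacobi_integral_shift p : J' ((1 - 'X^2) * p) = J p.
Proof.
rewrite !jacobi_integralE//; apply: eq_Rintegral => t /set_mem/=; rewrite in_itv/= => t11.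
rewrite /wpoly hornerM (_ : (1 - 'X^2).[t] = 1 - t ^+ 2); last by rewrite !hornerE.
rewrite mulrA (mulrC _ (1 - t ^+ 2)) mulr_powRB1//.
exact: one_subr_sqr_ge0.
Qed.

(* V is a multiple of v, the analogue of the contiguity relation
   C_l^(lambda - 1) = const * (C_l^(lambda) - X C_(l - 1)^(lambda)). *)
Let V : {poly R} := (2 * b)%:P * y + (1 - 'X^2) * (l%:R%:P * y - 'X * y^`()).

Let size_V : (size V <= l.+1)%N.
Proof.
rewrite (leq_trans (size_polyD _ _))// geq_max; apply/andP; split.
  by rewrite mul_polyC (leq_trans (size_scale_leq _ _))// sy.
(* The coefficient of degree i is (l - i) y_i. It vanishes at i = l, and at i = l - 1 by parity, so
   the factor 1 - 'X^2 brings the degree back to at most l. *)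
have sz : (size (l%:R%:P * y - 'X * y^`())%R <= l.-1)%N.
  apply/leq_sizeP => i li; rewrite coefB coefCM coefXM.
  have -> : (if i == 0%N then 0 else (y^`())`_i.-1) = i%:R * y`_i.
    by case: i {li} => [|i] /=; rewrite ?mul0r// coef_deriv mulr_natl.
  rewrite -mulrBl; have [->|il] := eqVneq i l; first by rewrite subrr mul0r.
  have [il1|il1] := eqVneq i l.-1.
    rewrite (orth_odd_coef b0 sy oy el) ?mulr0// il1.
    by move: el l2; case: (l) => [//|n] /=; rewrite negbK.
  by rewrite nth_default ?sy ?mulr0//; lia.
rewrite (leq_trans (size_polyMleq _ _))//.
have : (size (1 - 'X^2 : {poly R})%R <= 3)%N.
  by rewrite (leq_trans (size_polyD _ _))// size_polyN size_polyXn size_poly1.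
by move: sz; lia.
Qed.

Let orth_V q : (size q <= l)%N -> J' (V * q) = 0.
Proof.
move=> sq.
(* The added term is the derivative of (1 - t^2)^b t q y and integrates to 0. What remains is y
   times a polynomial of degree < l, in the weight with exponent b. *)
have E : V * q + wderiv b ('X * q * y) =
    (1 - 'X^2) * (y * ((l%:R + 1 + 2 * b)%:P * q + 'X * q^`())).
  by rewrite /V /wderiv !derivM derivX !polyCD !polyCM; ring.
have := jacobi_integral_ibp b1 ('X * q * y); rewrite subrK => ibp.
rewrite -[LHS]addr0 -ibp -(jacobi_integralD b1) E jacobi_integral_shift oy//.
rewrite (leq_trans (size_polyD _ _))// geq_max; apply/andP; split.
  by rewrite mul_polyC (leq_trans (size_scale_leq _ _)).
by have := size_mulXaddC_deriv 0 sq; rewrite addr0.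
Qed.

(** V(x) = -(1 - x^2) x y'(x) <= 0 < 2 b y(1) = V(1), so V, and with it v, has a root in [x, 1];
    hence x <= rho. *)
Lemma last_roots rho : is_max_root v rho -> exists x,
  [/\ 0 <= x < 1, x <= rho < 1, root y x &
      forall t, x < t <= 1 -> [/\ 0 < y.[t], 0 < y^`().[t] & 0 < y^`()^`().[t]]].
Proof.
move=> [rv rmax].
have rho1 : rho < 1 := orth_root_lt1 b1 sv ov rv.
have [z z0 rz] := orth_root_exists b0 sy oy (ltnW l2) y1.
have yN0 := orth_neq0 sy.
have z1 : z <= 1 := ltW (orth_root_lt1 b0 sy oy rz).
have [x [/andP[zx x1] rx xlast]] := last_root yN0 rz z1.
have {}x1 : x < 1 := orth_root_lt1 b0 sy oy rx.
have x0 : 0 <= x.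
  rewrite leNgt; apply/negP => x0.
  (* If x were negative, the mirror root -x would lie to the right of the last root. *)
  have := xlast (- x); rewrite /root (orth_hornerN b0 sy oy)// (eqP rx) eqxx.
  by move=> /(_ _)/negP H; apply: H => //; apply/andP; split; lra.
have ypos := poly_pos_sign xlast y1.
have xm1 : -1 <= x by lra.
have L1 : (2 : R) <= l%:R by rewrite ler_nat.
have dpos := deriv_gt0_of_ode xm1 x1 (_ : 0 < 2 * b + 2) (_ : 0 < gegen_eigen b l)
  (gegen_ode_horner b0 sy oy) ypos.
have {}dpos : forall t, x < t <= 1 -> 0 < y^`().[t].
  apply: dpos; first by have := b0; lra.
  by rewrite mulr_gt0//; have := b0; lra.
(* Differentiating the equation gives one of the same shape for y', with constant (l - 1) (l + 2 b +
   2) > 0. *)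
have ddpos : forall t, x < t <= 1 -> 0 < y^`()^`().[t].
  apply: (deriv_gt0_of_ode xm1 x1 (_ : 0 < 2 * b + 4)
    (_ : 0 < gegen_eigen b l - (2 * b + 2)) (gegen_ode_deriv_horner b0 sy oy) dpos).
    by have := b0; lra.
  rewrite /gegen_eigen; have := b0; move: (l%:R : R) L1 => u u2 b0'.
  suff : 0 < (u - 1) * (u + 2 * b + 2) by lra.
  by apply: mulr_gt0; lra.
have dx : 0 <= y^`().[x] := poly_ge0_left x1 dpos.
have Vx : V.[x] <= 0.
  rewrite /V !hornerE (eqP rx) !mulr0 !sub0r add0r.
  have : 0 <= (1 - x ^+ 2) * (x * y^`().[x]).
    by rewrite mulr_ge0 ?(mulr_ge0 x0 dx)// one_subr_sqr_ge0// xm1 ltW.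
  by lra.
have V1 : 0 < V.[1] by rewrite /V !hornerE expr1n subrr mul0r addr0 !mulr_gt0//; lra.
have [t /andP[xt t1] rt] := ivt_root (ltW x1) Vx (ltW V1).
have E := orth_proportional b1 sv ov size_V orth_V.
have vt : root v t.
  have := congr1 (fun p => p.[t]) E; rewrite !hornerZ (eqP rt) mulr0 => /esym/eqP.
  rewrite mulf_eq0 => /orP[|//] /eqP Vl0.
  have := congr1 (fun p => p.[1]) E; rewrite !hornerZ Vl0 mul0r => /eqP.
  by rewrite mulf_eq0 (negbTE (orth_lead_neq0 sv)) gt_eqF.
exists x; split => //; first by rewrite x0.
  by rewrite rho1 andbT (le_trans xt)// rmax.
by move=> s xs; split; [exact: ypos|exact: dpos|exact: ddpos].
Qed.

End lower_weight.

(** * Sonin's energy method *)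

Section poly_monotone.
Variable R : realType.
Implicit Types (c t x z : R) (p q : {poly R}).

Lemma horner_ndecr p x z : x <= z ->
  (forall t, x < t < z -> 0 <= p^`().[t]) -> p.[x] <= p.[z].
Proof.
move=> xz dp; apply: (@ger0_derive1_le_cc _ (horner p) x z) => //.
- move=> t; rewrite in_itv/= -derivE; exact: dp.
- by apply: continuous_subspaceT; exact: continuous_horner.
- by rewrite in_itv/= lexx.
- by rewrite in_itv/= lexx xz.
Qed.

Lemma wpoly_div_ndecr c q p x z : -1 < x -> x <= z -> z < 1 ->
  (forall t, x <= t <= z -> 0 < p.[t]) ->
  (forall t, x < t < z ->
    0 <= (wderiv c q).[t] * p.[t] - (1 - t ^+ 2) * q.[t] * p^`().[t]) ->
  wpoly c q x / p.[x] <= wpoly c q z / p.[z].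
Proof.
move=> x1 xz z1 ppos H; pose f t : R := wpoly c q t * (p.[t])^-1.
pose df t : R := wpoly (c - 1) (wderiv c q) t * (p.[t])^-1
  - wpoly c q t * ((p.[t]) ^- 2 * p^`().[t]).
have dft t : x <= t <= z -> is_derive t (1 : R) f (df t).
  move=> /andP[xt tz]; have t11 : -1 < t < 1 by apply/andP; split; lra.
  have pt : p.[t] != 0 by rewrite gt_eqF// ppos// xt tz.
  have dp : is_derive t (1 : R) (horner p) (p^`()).[t].
    split; first exact: derivable_horner.
    by rewrite -derive1E -derivE.
  apply: (is_derive_eq (is_deriveM (is_derive_wpoly c q t11) (is_deriveV pt dp))).
  rewrite -[_ *: (- _ *: _)]/(_ * (_ * _)) -[_ *: wpoly _ _ _]/(_ * _) /df.
  by ring.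
apply: (@ger0_derive1_le_cc _ f x z) => //.
- move=> t; rewrite in_itv/= => /andP[xt tz].
  by apply: (@ex_derive _ _ _ _ _ _ _ (dft t _)); rewrite !ltW.
- move=> t; rewrite in_itv/= => /andP[xt tz].
  have xtz : x <= t <= z by rewrite !ltW.
  have [_] := dft t xtz; rewrite -derive1E => ->; rewrite /df /wpoly.
  have t0 : 0 < 1 - t ^+ 2 by apply: one_subr_sqr_gt0; apply/andP; split; lra.
  rewrite (powR_mulrB1 c t0).
  have p0 := ppos t xtz.
  have -> : (1 - t ^+ 2) `^ (c - 1) * (wderiv c q).[t] / p.[t] -
      (1 - t ^+ 2) `^ (c - 1) * (1 - t ^+ 2) * q.[t] * (p.[t] ^- 2 * p^`().[t]) =
      (1 - t ^+ 2) `^ (c - 1) *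
      ((wderiv c q).[t] * p.[t] - (1 - t ^+ 2) * q.[t] * p^`().[t]) / p.[t] ^+ 2.
    by field; rewrite gt_eqF.
  by rewrite !mulr_ge0 ?powR_ge0 ?invr_ge0 ?sqr_ge0 ?H// xt.
- apply: derivable_within_continuous => t; rewrite in_itv/= => xtz.
  exact: (@ex_derive _ _ _ _ _ _ _ (dft t xtz)).
- by rewrite in_itv/= lexx.
- by rewrite in_itv/= lexx xz.
Qed.

End poly_monotone.

(* Sonin's method. In the variable t = cos theta, u = (1 - t^2)^(lam / 2) y
   satisfies u'' + phi u = 0 with phi = psi / (1 - t^2), and u' is a power of
   1 - t^2 times h. The energy phi u^2 + u'^2 is wpoly (lam - 1) energy, and
   u^2 + u'^2 / phi is wpoly lam energy / psi; they are respectively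
   nonincreasing and, as long as phi > 0, nondecreasing in t >= 0. *)
Section sonin.
Variables (R : realType) (lam : R) (l : nat) (y : {poly R}).
Implicit Types (t x z : R).
Local Notation b := (lam - 1 / 2).
Hypothesis ode : gegen_op b y = - gegen_eigen b l *: y.

Definition sonin_h : {poly R} := lam%:P * 'X * y - (1 - 'X^2) * y^`().

Definition sonin_psi : {poly R} :=
  (l%:R%:P + lam%:P) ^+ 2 * (1 - 'X^2) - lam%:P * (lam%:P - 1).

Definition sonin_energy : {poly R} := sonin_psi * y ^+ 2 + sonin_h ^+ 2.

Local Notation h := sonin_h.
Local Notation psi := sonin_psi.
Local Notation energy := sonin_energy.

Lemma sonin_psiE t : psi.[t] = (l%:R + lam) ^+ 2 * (1 - t ^+ 2) - lam * (lam - 1).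
Proof. by rewrite /psi !hornerE. Qed.

Lemma sonin_hE t : h.[t] = lam * t * y.[t] - (1 - t ^+ 2) * y^`().[t].
Proof. by rewrite /h !hornerE. Qed.

Lemma sonin_energyE t : energy.[t] = psi.[t] * y.[t] ^+ 2 + h.[t] ^+ 2.
Proof. by rewrite /energy !hornerE. Qed.

Let n2 : {poly R} := l%:R%:P.

Let ode' : (1 - 'X^2) * y^`()^`() =
  (2 * lam%:P + 1) * 'X * y^`() - n2 * (n2 + 2 * lam%:P) * y.
Proof.
have e1 : (2 * (b + 1))%:P = 2 * lam%:P + 1 :> {poly R}.
  by rewrite -polyC1 -polyCMn -polyCM -polyCD; congr (_%:P); field.
have e2 : (gegen_eigen b l)%:P = n2 * (n2 + 2 * lam%:P).
  by rewrite /n2 -polyCMn -polyCM -polyCD -polyCM; congr (_%:P); rewrite /gegen_eigen; field.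
have := ode; rewrite /gegen_op /wderiv -mul_polyC e1 polyCN e2 => E.
by apply/eqP; rewrite -subr_eq0; move/eqP: E; rewrite -subr_eq0 => /eqP <-; apply/eqP; ring.
Qed.

Let deriv_h : h^`() = (n2 * (n2 + 2 * lam%:P) + lam%:P) * y - (lam%:P - 1) * 'X * y^`().
Proof.
rewrite /h derivB !derivM derivC derivX derivB derivXn -polyC1 derivC.
transitivity (lam%:P * y + lam%:P * 'X * y^`() + 2 * 'X * y^`() - (1 - 'X^2) * y^`()^`()).
  by ring.
by rewrite ode'; ring.
Qed.

(** This is u'' + phi u = 0, freed of the powers of 1 - t^2. *)
Lemma sonin_h_deriv : (1 - 'X^2) * h^`() = (lam%:P - 1) * 'X * h + psi * y.
Proof. by rewrite deriv_h /psi /h -/n2; ring. Qed.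

Let deriv_psi : psi^`() = - (2 * (n2 + lam%:P) ^+ 2 * 'X).
Proof.
rewrite /psi -/n2 derivB derivM -!polyC1 -polyCB -polyCM -polyCD -rmorphXn/= !derivC derivB derivC derivXn.
by ring.
Qed.

(** In the derivative of phi u^2 + u'^2 the equation cancels all but phi' u^2, and phi decreases for
    t >= 0. *)
Lemma wderiv_energy : wderiv (lam - 1) energy =
  - (2 * lam%:P * (lam%:P - 1) * 'X * y ^+ 2).
Proof.
have e1 : (2 * (lam - 1))%:P = 2 * (lam%:P - 1) :> {poly R}.
  by rewrite -polyC1 -polyCMn -polyCB -polyCM.
rewrite /wderiv e1 /energy derivD derivM !deriv_exp deriv_psi !expr1.
transitivity ((1 - 'X^2) * (- (2 * (n2 + lam%:P) ^+ 2 * 'X) * y ^+ 2) +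
   psi * (2 * y * ((1 - 'X^2) * y^`())) + 2 * h * ((1 - 'X^2) * h^`())
   - 2 * (lam%:P - 1) * 'X * (psi * y ^+ 2 + h ^+ 2)).
  by ring.
rewrite sonin_h_deriv (_ : (1 - 'X^2) * y^`() = lam%:P * 'X * y - h); last by rewrite /h; ring.
by rewrite /psi -/n2; ring.
Qed.

Lemma wderiv_energyE t : (wderiv (lam - 1) energy).[t] =
  - (2 * lam * (lam - 1) * t * y.[t] ^+ 2).
Proof.
by rewrite wderiv_energy !(hornerD, hornerN, hornerM, hornerX, horner_exp, hornerMn, hornerC).
Qed.

(** The derivative of u u', which relates the integrals of u'^2 and phi u^2. *)
Lemma wderiv_yh : wderiv b (y * h) = psi * y ^+ 2 - h ^+ 2.
Proof.
have e1 : (2 * b)%:P = 2 * lam%:P - 1 :> {poly R}.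
  by rewrite -polyC1 -polyCMn -polyCM -polyCB; congr (_%:P); field.
rewrite /wderiv e1 derivM.
transitivity (((1 - 'X^2) * y^`()) * h + y * ((1 - 'X^2) * h^`()) - (2 * lam%:P - 1) * 'X * y * h).
  by ring.
rewrite sonin_h_deriv (_ : (1 - 'X^2) * y^`() = lam%:P * 'X * y - h); last by rewrite /h; ring.
by ring.
Qed.

Lemma wderiv_u : wderiv (lam / 2) y = - h.
Proof.
have e1 : (2 * (lam / 2))%:P = lam%:P :> {poly R} by congr (_%:P); field.
by rewrite /wderiv e1 /h; ring.
Qed.

End sonin.

Section sonin_bounds.
Variables (R : realType) (lam : R) (l : nat) (y : {poly R}).
Implicit Types (t x z s : R).
Local Notation b := (lam - 1 / 2).
Local Notation n := (l%:R : R).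
Hypotheses (lam2 : 2 <= lam) (l2 : (2 <= l)%N).
Hypothesis ode : gegen_op b y = - gegen_eigen b l *: y.
Hypothesis yN : forall t, y.[- t] = y.[t].
Hypothesis dyN : forall t, y^`().[- t] = - y^`().[t].

Local Notation h := (sonin_h lam y).
Local Notation psi := (sonin_psi lam l).
Local Notation energy := (sonin_energy lam l y).
Local Notation T := (wpoly (lam - 1) energy).
Local Notation nrm := (jacobi_integral b b (y * y)).
Local Notation N := (n + lam).
Local Notation top := (n * (n + 2 * lam) + lam).

Let n2 : 2 <= n. Proof. by rewrite ler_nat. Qed.

Lemma sonin_energy_nincr x z : 0 <= x -> x <= z -> z <= 1 -> T z <= T x.
Proof.
have l1 : 0 < lam - 1 by have := lam2; lra.
move=> x0 xz z1; apply: wpoly_nincr => //; first by lra.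
move=> t /andP[xt tz]; rewrite (wderiv_energyE ode).
have t0 : 0 <= t by lra.
have : 0 <= lam * (lam - 1) * t * y.[t] ^+ 2.
  by rewrite mulr_ge0 ?sqr_ge0 ?mulr_ge0//; have := lam2; lra.
by lra.
Qed.

(** Where psi < 0 the sign is not visible from the definition; it follows from monotonicity and T(1)
    = 0. *)
Lemma sonin_energy_ge0 t : 0 <= t <= 1 -> 0 <= T t.
Proof.
move=> /andP[t0 t1]; apply: le_trans (sonin_energy_nincr t0 t1 (lexx 1)).
by rewrite /wpoly expr1n subrr powR0 ?mul0r// gt_eqF//; have := lam2; lra.
Qed.

Lemma horner_energyN t : energy.[- t] = energy.[t].
Proof. by rewrite !sonin_energyE !sonin_psiE !sonin_hE yN dyN sqrrN; ring. Qed.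

Let horner_energy_ge0 t : -1 < t < 1 -> 0 <= energy.[t].
Proof.
wlog t0 : t / 0 <= t => [H t11|].
  have [/H|t0] := leP 0 t; first exact.
  case/andP: t11 => ? ?.
  by rewrite -[t]opprK horner_energyN H//; [lra|apply/andP; split; lra].
move=> /andP[tm1 t1]; have := @sonin_energy_ge0 t; rewrite t0 ltW// => /(_ isT).
by rewrite /wpoly pmulr_rge0// powR_gt0// one_subr_sqr_gt0// tm1.
Qed.

Let nrm_ge0 : 0 <= nrm.
Proof.
have b0 : 0 < b by have := lam2; lra.
rewrite jacobi_integralE//.
by apply: Rintegral_ge0 => t _; rewrite /wpoly hornerM -expr2 mulr_ge0 ?powR_ge0 ?sqr_ge0.
Qed.

(* Integrating by parts, int u'^2 = int phi u^2 <= phi(0) int u^2. *)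
Lemma sonin_energy_integral : jacobi_integral (b - 1) (b - 1) energy <= 2 * top * nrm.
Proof.
have b1 : 0 < b - 1 by have := lam2; lra.
have -> : jacobi_integral (b - 1) (b - 1) energy =
    jacobi_integral (b - 1) (b - 1) (2 *: (psi * (y * y))).
  have ibp := jacobi_integral_ibp b1 (y * h).
  rewrite subrK (wderiv_yh ode) in ibp.
  rewrite -[LHS]addr0 -ibp -(jacobi_integralD b1); congr jacobi_integral.
  by rewrite -mul_polyC polyCMn /sonin_energy; ring.
rewrite -(jacobi_integral_shift b1) -(jacobi_integralZ b1).
apply: (ler_jacobi_integral b1) => t t11.
rewrite !hornerZ !hornerM sonin_psiE (_ : (1 - 'X^2).[t] = 1 - t ^+ 2); last by rewrite !hornerE.
have y0 : 0 <= y.[t] * y.[t] by rewrite -expr2 sqr_ge0.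
have : 0 <= lam * (lam - 1) * t ^+ 2 * (y.[t] * y.[t]).
  by have := lam2 => A; rewrite mulr_ge0// mulr_ge0 ?sqr_ge0// mulr_ge0//; lra.
by lra.
Qed.

(** T is nonincreasing, so its integral over [0, t] is at least t T(t). *)
Lemma sonin_energy_bound t : 0 < t < 1 -> t * T t <= 2 * top * nrm.
Proof.
move=> /andP[t0 t1]; apply: le_trans sonin_energy_integral.
have b1 : 0 < b - 1 by have := lam2; lra.
rewrite mulrC -[X in _ * X]subr0; apply: (jacobi_integral_ge_itv b1 _ (ltW t0) (ltW t1)); first by lra.
move=> s /andP[sm1 s1].
have [s11|] := boolP (-1 < s < 1); last first.
  move=> sN; have s2 : 1 - s ^+ 2 = 0.
    have [sE|s1'] := eqVneq s 1; first by rewrite sE expr1n subrr.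
    have [sE|s2'] := eqVneq s (-1); first by rewrite sE sqrrN expr1n subrr.
    by move: sN; rewrite lt_neqAle eq_sym s2' sm1 lt_neqAle s1' s1.
  rewrite /wpoly s2 powR0 ?mul0r; last by rewrite gt_eqF.
  case: ifP => // /andP[s0 st]; move/eqP: s2; rewrite subr_eq0 eq_sym sqrf_eq1.
  by move=> /orP[/eqP|/eqP] sE; lra.
have e0 := horner_energy_ge0 s11; have w0 := one_subr_sqr_gt0 s11.
case: ifP => [/andP[s0 st]|_]; last by rewrite /wpoly mulr_ge0 ?powR_ge0.
apply: le_trans (sonin_energy_nincr s0 st (ltW t1)) _.
(* The base 1 - s^2 is at most 1 and b - 1 = lam - 3/2 is below lam - 1, so the integrand dominates
   T. *)
rewrite /wpoly ler_wpM2r// ger_powR//; last by lra.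
by rewrite w0/= lerBlDr lerDl sqr_ge0.
Qed.

(* phi vanishes at t_star; t_one lies within the Airy scale of it. *)
Let t_star : R := Num.sqrt top / N.
Let t_one : R := t_star - lam / N ^+ 2.

Let topE : top = N ^+ 2 - lam * (lam - 1). Proof. by ring. Qed.
Let N0 : 0 < N. Proof. by have := n2; have := lam2; lra. Qed.
Let top0 : 0 < top.
Proof. by have := n2; have := lam2; move=> A B; rewrite addr_gt0 ?mulr_gt0//; lra. Qed.

Let t_star0 : 0 < t_star. Proof. by rewrite divr_gt0 ?sqrtr_gt0. Qed.

Let t_star_sqr : N ^+ 2 * t_star ^+ 2 = top.
Proof. by rewrite /t_star expr_div_n sqr_sqrtr ?ltW// mulrC divfK// gt_eqF// exprn_gt0. Qed.

Let t_star1 : t_star < 1.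
Proof.
rewrite /t_star ltr_pdivrMr// mul1r -(@ltr_pXn2r _ 2)// ?nnegrE ?sqrtr_ge0 ?ltW//.
rewrite sqr_sqrtr ?ltW//; have := topE; have := lam2; move=> A ->.
suff : 0 < lam * (lam - 1) by lra.
by rewrite mulr_gt0//; lra.
Qed.

Let t_one_half : t_star / 2 <= t_one.
Proof.
rewrite /t_one; suff : lam / N ^+ 2 <= t_star / 2 by lra.
rewrite /t_star ler_pdivrMr ?exprn_gt0//.
have -> : Num.sqrt top / N / 2 * N ^+ 2 = Num.sqrt top * N / 2.
  by field; rewrite gt_eqF.
have s2 : 2 <= Num.sqrt top.
  rewrite -(@ler_pXn2r _ 2)// ?nnegrE ?sqrtr_ge0// sqr_sqrtr ?(ltW top0)//.
  have A := n2; have B := lam2.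
  have : 0 <= (n - 2) * (n + 2 * lam) by rewrite mulr_ge0; lra.
  by lra.
have := n2; have := lam2; move: (Num.sqrt top) s2 => r r2 A B.
suff : 0 <= (r - 2) * N + 2 * n by lra.
by rewrite addr_ge0 ?mulr_ge0//; lra.
Qed.

Let t_one0 : 0 < t_one. Proof. by have := t_one_half; have := t_star0; lra. Qed.

Let t_one_lt : t_one < t_star.
Proof.
rewrite /t_one ltrBlDr ltrDl divr_gt0 ?exprn_gt0//; have := lam2; lra.
Qed.

Let psiE t : psi.[t] = N ^+ 2 * (t_star ^+ 2 - t ^+ 2).
Proof. by rewrite sonin_psiE [RHS]mulrBr t_star_sqr; ring. Qed.

(** With [w_t_one] this bounds (1 - t^2) / psi at [t_one] by 2 lam / (N^2 [t_star]). The [t_star]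
    here cancels the one in [T_t_one]. *)
Let psi_t_one : lam * t_star <= psi.[t_one].
Proof.
rewrite psiE; have -> : t_star ^+ 2 - t_one ^+ 2 = lam / N ^+ 2 * (t_star + t_one).
  by rewrite /t_one; ring.
rewrite mulrA (mulrC _ (lam / _)) divfK; last by rewrite gt_eqF ?exprn_gt0.
by rewrite ler_wpM2l//; have := lam2; have := t_one0; lra.
Qed.

Let w_t_one : N ^+ 2 * (1 - t_one ^+ 2) <= 2 * lam ^+ 2.
Proof.
have := sonin_psiE lam l t_one; rewrite psiE => E.
have : N ^+ 2 * (t_star ^+ 2 - t_one ^+ 2) <= 2 * lam.
  have -> : t_star ^+ 2 - t_one ^+ 2 = lam / N ^+ 2 * (t_star + t_one).
    by rewrite /t_one; ring.
  rewrite mulrA (mulrC _ (lam / _)) divfK; last by rewrite gt_eqF ?exprn_gt0.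
  rewrite (mulrC 2) ler_wpM2l//; have := lam2; have := t_star1; have := t_one_lt; lra.
by have := lam2; nra.
Qed.

Let T_t_one : T t_one <= 4 * N ^+ 2 * t_star * nrm.
Proof.
have t1 : 0 < t_one < 1.
  by have := t_one0; have := t_one_lt; have := t_star1 => A B C; apply/andP; split; lra.
have := sonin_energy_bound t1; rewrite -t_star_sqr => H.
have t10 := t_one0.
rewrite -(ler_pM2l t10) (le_trans H)//.
have := t_one_half; have := t_star0; have := nrm_ge0; have := sqr_ge0 N.
move: (t_one) (t_star) (N ^+ 2) (nrm) => u v M k M0 k0 v0 uv.
have : 0 <= M * v * k * (2 * u - v) by rewrite !mulr_ge0//; lra.
by lra.
Qed.

Let psi_gt0 t : 0 <= t -> t < t_star -> 0 < psi.[t].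
Proof.
move=> t0 tt; rewrite psiE mulr_gt0 ?exprn_gt0// subr_gt0.
by rewrite ltr_pXn2r// nnegrE ltW.
Qed.

(** The left side is u^2 + u'^2 / phi, so its value at [t_one] is the largest one. *)
Let ratio_bound t : 0 <= t -> t <= t_one ->
  wpoly lam energy t / psi.[t] <= 8 * lam * nrm.
Proof.
have lt1 := t_one_lt; have ls1 := t_star1; have to0 := t_one0.
move=> t0 tt; have : wpoly lam energy t / psi.[t] <= wpoly lam energy t_one / psi.[t_one].
  apply: wpoly_div_ndecr => //; [by lra|by lra| |].
    by move=> s /andP[ts st]; apply: psi_gt0; lra.
  move=> s /andP[ts st].
  have -> : (wderiv lam energy).[s] = (wderiv (lam - 1) energy).[s] - 2 * s * energy.[s].
    by rewrite /wderiv !hornerE; ring.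
  have -> : psi^`().[s] = - (2 * N ^+ 2 * s).
    rewrite /sonin_psi derivB derivM -!polyC1 -polyCB -polyCM -polyCD -rmorphXn/= !derivC.
    rewrite derivB derivC derivXn.
    by rewrite !(hornerD, hornerN, hornerM, hornerX, horner_exp, hornerMn, hornerC); ring.
  rewrite (wderiv_energyE ode) sonin_energyE sonin_psiE.
  (* The numerator of the derivative collapses to twice this quantity. *)
  have : 0 <= lam * (lam - 1) * s * h.[s] ^+ 2.
    by rewrite mulr_ge0 ?sqr_ge0 ?mulr_ge0//; have := lam2; lra.
  by lra.
move=> /le_trans; apply.
have t11 : -1 < t_one < 1 by apply/andP; split; lra.
have w0 := one_subr_sqr_gt0 t11.
have -> : wpoly lam energy t_one = T t_one * (1 - t_one ^+ 2).
  by rewrite /wpoly (powR_mulrB1 lam w0) mulrAC.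
have p0 : 0 < psi.[t_one] by apply: psi_gt0 => //; exact: ltW.
rewrite ler_pdivrMr//.
have T0 : 0 <= T t_one by apply: sonin_energy_ge0; apply/andP; split; lra.
apply: (@le_trans _ _ (4 * N ^+ 2 * t_star * nrm * (1 - t_one ^+ 2))).
  by rewrite ler_wpM2r ?T_t_one// ltW.
have s0 := t_star0; have k0 := nrm_ge0.
apply: (@le_trans _ _ (4 * t_star * nrm * (2 * lam ^+ 2))).
  rewrite (_ : _ * (1 - t_one ^+ 2) = 4 * t_star * nrm * (N ^+ 2 * (1 - t_one ^+ 2))); last by ring.
  by rewrite ler_wpM2l ?w_t_one// mulr_ge0// mulr_ge0// ltW.
rewrite (_ : 4 * _ * _ * _ = 8 * lam * nrm * (lam * t_star)); last by ring.
by rewrite ler_wpM2l ?psi_t_one// !mulr_ge0//; have := lam2; lra.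
Qed.

Let u_bound_inner t : 0 <= t -> t <= t_one ->
  (1 - t ^+ 2) `^ lam * y.[t] ^+ 2 <= 8 * lam * nrm.
Proof.
have lt1 := t_one_lt; have ls1 := t_star1; move=> t0 tt.
apply: le_trans (ratio_bound t0 tt).
have p0 : 0 < psi.[t] by apply: psi_gt0 => //; lra.
rewrite ler_pdivlMr// /wpoly -mulrA ler_wpM2l ?powR_ge0// sonin_energyE.
by rewrite mulrC lerDl sqr_ge0.
Qed.

(** [sonin_energy_bound] is useless near t = 0. Up to [t_one], [ratio_bound] is multiplied by phi(t)
    <= phi(0) = [top] instead; beyond it T only decreases. *)
Lemma sonin_energy_uniform t : 0 <= t <= 1 -> T t <= 8 * lam * top * nrm.
Proof.
have lt1 := t_one_lt; have ls1 := t_star1; have to0 := t_one0.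
wlog tt : t / t <= t_one => [H /andP[t0 t1]|/andP[t0 t1]].
  have [tt|tt] := leP t t_one; first by apply: H => //; rewrite t0.
  apply: le_trans (sonin_energy_nincr (ltW to0) (ltW tt) t1) _.
  by apply: H => //; apply/andP; split; lra.
have p0 : 0 < psi.[t] by apply: psi_gt0 => //; lra.
have w0 : 0 < 1 - t ^+ 2 by apply: one_subr_sqr_gt0; apply/andP; split; lra.
have := ratio_bound t0 tt; rewrite ler_pdivrMr// => H.
rewrite -(ler_pM2r w0).
have -> : T t * (1 - t ^+ 2) = wpoly lam energy t by rewrite /wpoly (powR_mulrB1 lam w0) mulrAC.
apply: le_trans H _.
have -> : 8 * lam * top * nrm * (1 - t ^+ 2) = 8 * lam * nrm * (top * (1 - t ^+ 2)) by ring.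
have := nrm_ge0; have := lam2 => A k0.
rewrite ler_wpM2l ?mulr_ge0//; first by lra.
rewrite sonin_psiE topE.
have : 0 <= lam * (lam - 1) * t ^+ 2 by rewrite mulr_ge0 ?sqr_ge0 ?mulr_ge0//; lra.
by lra.
Qed.

Lemma sonin_h_bound t : 0 <= t <= 1 -> 0 <= psi.[t] ->
  (1 - t ^+ 2) `^ (lam - 1) * h.[t] ^+ 2 <= 8 * lam * top * nrm.
Proof.
move=> t01 pt; apply: le_trans (sonin_energy_uniform t01).
by rewrite /wpoly ler_wpM2l ?powR_ge0// sonin_energyE lerDr mulr_ge0 ?sqr_ge0.
Qed.

(* Beyond t_one the width of [t_one, t_star] is so small that the bound on u'
   suffices. *)
Let u_bound_outer t : t_one < t -> 0 <= psi.[t] ->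
  (1 - t ^+ 2) `^ lam * y.[t] ^+ 2 <= 24 * lam * nrm.
Proof.
have to0 := t_one0; have ts1 := t_star1; have ts0 := t_star0; have L2 := lam2.
move=> tt; rewrite psiE pmulr_rge0 ?exprn_gt0// subr_ge0 => tts.
have tstar : t <= t_star by rewrite -(@ler_pXn2r _ 2)// nnegrE; lra.
have hl : 0 < lam / 2 by lra.
have [s /andP[s1 s2]] := @wpoly_mean_value R (lam / 2) y t_one t hl
  ltac:(lra) tt ltac:(lra).
rewrite wderiv_u.
have w0 x : 0 <= x -> x <= t_star -> 0 < 1 - x ^+ 2.
  by move=> x0 x1; apply: one_subr_sqr_gt0; apply/andP; split; lra.
have sq x : 0 <= x -> x <= t_star ->
    wpoly (lam / 2) y x ^+ 2 = (1 - x ^+ 2) `^ lam * y.[x] ^+ 2.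
  move=> x0 x1; rewrite /wpoly exprMn expr2 -powRD -?splitr//.
  by rewrite (gt_eqF (w0 _ x0 x1)) implybT.
have ws0 : 0 < 1 - s ^+ 2 by apply: w0; lra.
set A := wpoly _ y t; set B := wpoly _ y t_one; set D := wpoly _ _ s => E.
have HB : B ^+ 2 <= 8 * lam * nrm.
  by rewrite /B sq; [apply: u_bound_inner; lra|lra|lra].
rewrite -sq; [|lra|lra].
rewrite -/A.
have HD : (1 - s ^+ 2) * D ^+ 2 <= T t_one.
  apply: (@le_trans _ _ (T s)); last first.
    by apply: sonin_energy_nincr; lra.
  have -> : (1 - s ^+ 2) * D ^+ 2 = (1 - s ^+ 2) `^ (lam - 1) * h.[s] ^+ 2.
    rewrite /D /wpoly hornerN mulrN sqrrN exprMn mulrA; congr (_ * _).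
    rewrite [(_ `^ _) ^+ 2]expr2 -powRD; last by rewrite (gt_eqF ws0) implybT.
    rewrite -[X in X * _](powRr1 (ltW ws0)) -powRD; last by rewrite (gt_eqF ws0) implybT.
    by congr (_ `^ _); field.
  rewrite /wpoly ler_wpM2l ?powR_ge0// sonin_energyE lerDr mulr_ge0 ?sqr_ge0//.
  rewrite psiE mulr_ge0 ?sqr_ge0// subr_ge0 ler_pXn2r ?nnegrE//; lra.
(* psi(s) >= 0 means lam (lam - 1) <= N^2 (1 - s^2), and lam^2 <= 2 lam (lam - 1) since lam >= 2. *)
have W : lam ^+ 2 <= 2 * (N ^+ 2 * (1 - s ^+ 2)).
  have : 0 <= psi.[s].
    by rewrite psiE mulr_ge0 ?sqr_ge0// subr_ge0 ler_pXn2r ?nnegrE//; lra.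
  by rewrite sonin_psiE; nra.
have k0 := nrm_ge0.
have DN : D ^+ 2 * (lam ^+ 2) <= 8 * (N ^+ 2) ^+ 2 * nrm.
  apply: (@le_trans _ _ (2 * N ^+ 2 * ((1 - s ^+ 2) * D ^+ 2))).
    rewrite (_ : 2 * _ * _ = D ^+ 2 * (2 * (N ^+ 2 * (1 - s ^+ 2)))); last by ring.
    by rewrite ler_wpM2l ?sqr_ge0.
  apply: (@le_trans _ _ (2 * N ^+ 2 * (4 * N ^+ 2 * t_star * nrm))).
    by apply: ler_wpM2l; [rewrite mulr_ge0 ?sqr_ge0|exact: le_trans HD T_t_one].
  have : 0 <= (N ^+ 2) ^+ 2 * nrm * (1 - t_star).
    by apply: mulr_ge0; [rewrite mulr_ge0 ?sqr_ge0|lra].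
  by lra.
have dt : (t - t_one) ^+ 2 * (N ^+ 2) ^+ 2 <= lam ^+ 2.
  have N20 : 0 < N ^+ 2 by rewrite exprn_gt0.
  have K : (t - t_one) * N ^+ 2 <= lam.
    by rewrite -ler_pdivlMr//; move: tstar; rewrite /t_one; lra.
  rewrite -exprMn; apply: lerXn2r => //; rewrite nnegrE; last by lra.
  by apply: mulr_ge0; [lra|exact: ltW].
have HAB : (A - B) ^+ 2 <= 8 * nrm.
  have l20 : 0 < lam ^+ 2 by rewrite exprn_gt0//; lra.
  rewrite E exprMn -(ler_pM2r l20).
  apply: (@le_trans _ _ (8 * (N ^+ 2) ^+ 2 * nrm * (t - t_one) ^+ 2)).
    rewrite (_ : _ * _ * lam ^+ 2 = D ^+ 2 * lam ^+ 2 * (t - t_one) ^+ 2); last by ring.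
    by rewrite ler_wpM2r ?sqr_ge0.
  rewrite (_ : _ * (t - t_one) ^+ 2 = 8 * nrm * ((t - t_one) ^+ 2 * (N ^+ 2) ^+ 2)); last by ring.
  by rewrite ler_wpM2l// mulr_ge0.
have HA : A ^+ 2 <= 2 * (A - B) ^+ 2 + 2 * B ^+ 2.
  by have := sqr_ge0 (A - 2 * B); lra.
(* The two squares add up to 16 [nrm] + 16 lam [nrm], at most 24 lam [nrm] since lam >= 2. *)
have : 0 <= nrm * (lam - 2) by rewrite mulr_ge0//; lra.
by lra.
Qed.

Lemma sonin_u_bound t : 0 <= t <= 1 -> 0 <= psi.[t] ->
  (1 - t ^+ 2) `^ lam * y.[t] ^+ 2 <= 24 * lam * nrm.
Proof.
move=> /andP[t0 t1] pt; have [tt|tt] := leP t t_one; last exact: u_bound_outer.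
apply: le_trans (u_bound_inner t0 tt) _.
have : 0 <= lam * nrm by rewrite mulr_ge0//; have := lam2; lra.
by lra.
Qed.

End sonin_bounds.

(** * The upper bound for the kernel *)

Section kernel_bound.
Variables (R : realType) (lam : R) (l : nat) (y : {poly R}) (x : R).
Implicit Types (t z s : R).
Local Notation b := (lam - 1 / 2).
Local Notation n := (l%:R : R).
Hypotheses (lam2 : 2 <= lam) (l2 : (2 <= l)%N).
Hypothesis ode : gegen_op b y = - gegen_eigen b l *: y.
Hypothesis yN : forall t, y.[- t] = y.[t].
Hypothesis dyN : forall t, y^`().[- t] = - y^`().[t].
Hypotheses (x01 : 0 <= x < 1) (rx : root y x) (simple_x : y^`().[x] != 0).
Hypothesis pos : forall t, x < t <= 1 -> [/\ 0 < y.[t], 0 < y^`().[t] & 0 < y^`()^`().[t]].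

Local Notation h := (sonin_h lam y).
Local Notation psi := (sonin_psi lam l).
Local Notation nrm := (jacobi_integral b b (y * y)).
Local Notation L := (n * (n + 2 * lam)).

Let ode_t t : (1 - t ^+ 2) * y^`()^`().[t] = (2 * lam + 1) * t * y^`().[t] - L * y.[t].
Proof.
have E : (gegen_op b y).[t] = (- gegen_eigen b l *: y).[t] by rewrite ode.
by rewrite /gegen_op /wderiv /gegen_eigen !hornerE in E; lra.
Qed.

Let n2 : 2 <= n. Proof. by rewrite ler_nat. Qed.

Let dy1 : L * y.[1] = (2 * lam + 1) * y^`().[1].
Proof. by have := ode_t 1; rewrite expr1n subrr mul0r mulr1; lra. Qed.

Let dyx : 0 < y^`().[x].
Proof.
case/andP: x01 => _ x1; rewrite lt_neqAle eq_sym simple_x.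
by apply: (poly_ge0_left x1) => t /pos[].
Qed.

(** As u' changes sign between x and 1, h has a last zero z there, and h'(z) >= 0. But (1 - z^2)
    h'(z) = psi(z) y(z) with y(z) > 0, so psi(z) >= 0; and psi decreases on [x, z]. *)
Lemma sonin_psi_last_root : 0 <= psi.[x].
Proof.
have A := lam2; case/andP: x01 => x0 x1.
have y1 : 0 < y.[1] by case: (@pos 1); rewrite ?x1/=.
have hx : h.[x] < 0.
  rewrite sonin_hE (eqP rx) mulr0 sub0r oppr_lt0 mulr_gt0// one_subr_sqr_gt0//.
  by rewrite x1 andbT; lra.
have h1 : 0 < h.[1] by rewrite sonin_hE expr1n subrr mul0r subr0 mulr1 mulr_gt0//; lra.
have h0 : h != 0 by apply: contraTneq h1 => ->; rewrite horner0 ltxx.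
have [s /andP[xs s1] rs] := ivt_root (ltW x1) (ltW hx) (ltW h1).
have [z [/andP[sz z1] rz zlast]] := last_root h0 rs s1.
have {}z1 : z < 1.
  by rewrite lt_neqAle z1 andbT; apply/eqP => E; move: rz; rewrite E /root gt_eqF.
have xz : x < z.
  rewrite lt_neqAle (le_trans xs sz) andbT; apply/eqP => E.
  by move: rz hx; rewrite -E => /eqP ->; rewrite ltxx.
have [q hq] := factor_theorem _ _ rz.
have qz : 0 <= q.[z].
  apply: (poly_ge0_left z1) => t /andP[zt t1].
  have : 0 < h.[t] by apply: (poly_pos_sign zlast h1); rewrite zt t1.
  by rewrite hq hornerM hornerXsubC pmulr_lgt0// subr_gt0.
have E : (1 - z ^+ 2) * h^`().[z] = psi.[z] * y.[z].
  have := sonin_h_deriv ode; move: (h) (psi) rz => H P /eqP Hz E.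
  have : ((1 - 'X^2) * H^`()).[z] = ((lam%:P - 1) * 'X * H + P * y).[z] by rewrite E.
  by rewrite hornerD !hornerM Hz mulr0 add0r => <-; congr (_ * _); rewrite !hornerE.
have [yz _ _] : [/\ 0 < y.[z], 0 < y^`().[z] & 0 < y^`()^`().[z]].
  by apply: pos; rewrite xz ltW.
have : 0 <= psi.[z].
  rewrite -(pmulr_lge0 _ yz) -E hq horner_factor_deriv mulr_ge0//.
  by rewrite one_subr_sqr_ge0// (ltW z1) andbT; lra.
rewrite !sonin_psiE => H; apply: le_trans H _.
rewrite lerB// ler_wpM2l ?sqr_ge0// lerB// lerXn2r// ?nnegrE; lra.
Qed.

(** By convexity y(1) <= y'(1) (1 - x); the equation at 1 turns this into a lower bound for 1 -
    x. *)
Let gap : 2 * lam + 1 <= L * (1 - x).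
Proof.
case/andP: x01 => x0 x1.
have [y1 dy1' _] : [/\ 0 < y.[1], 0 < y^`().[1] & 0 < y^`()^`().[1]].
  by apply: pos; rewrite x1/=.
have dle t : x < t < 1 -> y^`().[t] <= y^`().[1].
  move=> /andP[xt t1]; apply: horner_ndecr; first exact: ltW.
  move=> s /andP[ts s1]; have [_ _ ?] : [/\ 0 < y.[s], 0 < y^`().[s] & 0 < y^`()^`().[s]].
    by apply: pos; rewrite (lt_trans xt ts) ltW.
  exact: ltW.
have H : y.[1] <= y^`().[1] * (1 - x).
  suff : y^`().[1] * x - 0 <= y^`().[1] * 1 - y.[1] by lra.
  have := @horner_ndecr _ ((y^`().[1])%:P * 'X - y) x 1 (ltW x1).
  rewrite !(hornerD, hornerN, hornerM, hornerC, hornerX) (eqP rx); apply.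
  move=> t xt; rewrite derivB derivM derivC derivX mul0r add0r mulr1 hornerD hornerN hornerC.
  by rewrite subr_ge0 dle.
have A := lam2; rewrite -(ler_pM2r y1) mulrAC dy1 -mulrA ler_wpM2l//; lra.
Qed.

Let K : R := Num.sqrt (lam * nrm / (1 - x ^+ 2) `^ lam).

Let nrm0 : 0 <= nrm.
Proof.
have b0 : 0 < b by have := lam2; lra.
rewrite jacobi_integralE//.
by apply: Rintegral_ge0 => t _; rewrite /wpoly hornerM -expr2 mulr_ge0 ?powR_ge0 ?sqr_ge0.
Qed.

Let K0 : 0 <= K. Proof. exact: sqrtr_ge0. Qed.

Let wx : 0 < 1 - x ^+ 2.
Proof. by case/andP: x01 => ? ?; apply: one_subr_sqr_gt0; apply/andP; split; lra. Qed.

Let K2 : lam * nrm = K ^+ 2 * (1 - x ^+ 2) `^ lam.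
Proof.
have A := lam2; have w0 := powR_gt0 lam wx.
rewrite sqr_sqrtr ?divfK ?gt_eqF//.
by rewrite divr_ge0 ?(ltW w0)// mulr_ge0//; lra.
Qed.

Section inner.
Variable t : R.
Hypothesis t0x : 0 <= t <= x.

Let t01 : 0 <= t <= 1.
Proof. by case/andP: x01 t0x => ? ? /andP[? ?]; apply/andP; split; lra. Qed.

Let psit : 0 <= psi.[t].
Proof.
case/andP: t0x => t0 tx; apply: le_trans sonin_psi_last_root _.
by rewrite !sonin_psiE lerB// ler_wpM2l ?sqr_ge0// lerB// lerXn2r// nnegrE (le_trans t0).
Qed.

Let wt : 0 < 1 - t ^+ 2.
Proof. by case/andP: x01 t0x => ? ? /andP[? ?]; apply: one_subr_sqr_gt0; apply/andP; split; lra. Qed.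

Let wxt : (1 - x ^+ 2) `^ lam <= (1 - t ^+ 2) `^ lam.
Proof.
case/andP: t0x => t0 tx; have A := lam2.
apply: ge0_ler_powR; [by lra|by rewrite nnegrE ltW|by rewrite nnegrE ltW|].
by rewrite lerB// lerXn2r// nnegrE (le_trans t0 tx).
Qed.

Let y_sqr : y.[t] ^+ 2 <= 24 * K ^+ 2.
Proof.
rewrite -(ler_pM2l (powR_gt0 lam wx)).
apply: (@le_trans _ _ ((1 - t ^+ 2) `^ lam * y.[t] ^+ 2)).
  by rewrite ler_wpM2r ?sqr_ge0.
apply: le_trans (sonin_u_bound lam2 l2 ode yN dyN t01 psit) _.
by rewrite -mulrA K2; lra.
Qed.

Let h_sqr : h.[t] ^+ 2 <= 8 * (L + lam) * (1 - t ^+ 2) * K ^+ 2.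
Proof.
rewrite -(ler_pM2l (powR_gt0 lam wx)).
apply: (@le_trans _ _ ((1 - t ^+ 2) `^ lam * h.[t] ^+ 2)).
  by rewrite ler_wpM2r ?sqr_ge0.
rewrite (powR_mulrB1 lam wt).
have := sonin_h_bound lam2 l2 ode yN dyN t01 psit.
rewrite -(ler_pM2r wt) => H.
rewrite mulrAC; apply: le_trans H _.
have -> : 8 * lam * (L + lam) * nrm * (1 - t ^+ 2) =
  8 * (L + lam) * (1 - t ^+ 2) * (lam * nrm) by ring.
by rewrite K2; lra.
Qed.

Lemma abs_y_le : `|y.[t]| <= 5 * K.
Proof.
rewrite -(@ler_pXn2r _ 2)// ?nnegrE ?normr_ge0// ?mulr_ge0// real_normK ?num_real//.
by apply: le_trans y_sqr _; have := sqr_ge0 K; lra.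
Qed.

(** Solving for y' in h = lam t y - (1 - t^2) y' means dividing by s = 1 - t^2, which is safe
    because [gap] gives s L >= 2 lam >= 4. The contributions of y and h are at most 12 and 8 times
    (s L K)^2, within 5^2. *)
Lemma abs_deriv_y_le : `|y^`().[t]| <= 5 * L * K.
Proof.
have A := lam2; have B := n2.
have L0 : 0 < L by rewrite mulr_gt0//; lra.
have LK0 : 0 <= 5 * L * K by rewrite mulr_ge0// mulr_ge0// ltW.
rewrite -(@ler_pXn2r _ 2)// ?nnegrE//.
rewrite real_normK ?num_real//.
have sL : 2 * lam <= (1 - t ^+ 2) * L.
  case/andP: x01 t0x => x0 x1 /andP[t0 tx].
  apply: (@le_trans _ _ (L * (1 - x))); first by have := gap; lra.
  by rewrite mulrC ler_wpM2r ?(ltW L0)//; nra.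
have w0 := wt; have hs := h_sqr.
set s := 1 - t ^+ 2 in sL w0 hs *.
have s2 : 0 < s ^+ 2 by rewrite exprn_gt0.
rewrite -(ler_pM2l s2).
have E : s * y^`().[t] = lam * t * y.[t] - h.[t] by rewrite sonin_hE -/s; ring.
have -> : s ^+ 2 * y^`().[t] ^+ 2 = (s * y^`().[t]) ^+ 2 by rewrite exprMn.
rewrite E.
have H1 : (lam * t * y.[t] - h.[t]) ^+ 2 <= 2 * (lam * t * y.[t]) ^+ 2 + 2 * h.[t] ^+ 2.
  by have := sqr_ge0 (lam * t * y.[t] + h.[t]); lra.
have H2 : (lam * t * y.[t]) ^+ 2 <= lam ^+ 2 * (24 * K ^+ 2).
  rewrite mulrAC exprMn -[X in _ <= X]mulr1 ler_pM ?sqr_ge0//.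
    by rewrite exprMn ler_wpM2l ?sqr_ge0.
  by case/andP: t01 => t0 t1; rewrite expr_le1.
have k0 := sqr_ge0 K.
have H3 : 4 * lam ^+ 2 * K ^+ 2 <= (s * L) ^+ 2 * K ^+ 2.
  rewrite ler_wpM2r//; apply: (@le_trans _ _ ((2 * lam) ^+ 2)); first by rewrite exprMn; lra.
  by rewrite lerXn2r// nnegrE; lra.
have H4 : 4 * (s * L) * K ^+ 2 <= (s * L) ^+ 2 * K ^+ 2.
  by rewrite ler_wpM2r// expr2 ler_wpM2r; lra.
have H5 : (L + lam) * s * K ^+ 2 <= 2 * (s * L) * K ^+ 2.
  rewrite ler_wpM2r// (mulrC s) mulrA ler_wpM2r ?(ltW w0)//.
  by rewrite (_ : 2 * L = L + L); [rewrite lerD2l; nra|ring].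
have H6 : 0 <= (s * L) ^+ 2 * K ^+ 2 by rewrite mulr_ge0 ?sqr_ge0.
have -> : s ^+ 2 * (5 * L * K) ^+ 2 = 25 * ((s * L) ^+ 2 * K ^+ 2) by ring.
by lra.
Qed.

End inner.

Lemma dual_kernel_upper t : -1 <= t <= 1 ->
  (1 + t) * y^`().[t] - 2 * L * y.[t] <= 20 * L * K.
Proof.
have A := lam2; have B := n2.
have L0 : 0 < L by rewrite mulr_gt0//; lra.
have LK : 0 <= L * K by rewrite mulr_ge0// ltW.
case/andP: (x01) => x0 x1 /andP[tm1 t1].
have inner s : -1 <= s <= 1 -> 0 <= `|s| <= x ->
    (1 + s) * y^`().[s] - 2 * L * y.[s] <= 20 * L * K.
  move=> /andP[sm1 s1] sx.
  have [ay ady] : `|y.[s]| <= 5 * K /\ `|y^`().[s]| <= 5 * L * K.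
    have := abs_y_le sx; have := abs_deriv_y_le sx.
    by case: (ger0P s) => _; rewrite ?yN ?dyN ?normrN.
  have H1 : (1 + s) * y^`().[s] <= 2 * (5 * L * K).
    apply: le_trans (ler_norm _) _; rewrite normrM ler_pM// ger0_norm; lra.
  have H2 : - (L * (5 * K)) <= L * y.[s].
    rewrite -mulrN ler_wpM2l ?(ltW L0)//.
    by move: ay; rewrite ler_norml => /andP[].
  by lra.
have [tx|tx] := leP `|t| x.
  by apply: inner; [rewrite tm1|rewrite normr_ge0].
have [t0|t0] := leP 0 t; last first.
  rewrite ltr0_norm// in tx.
  have [yt dyt _] : [/\ 0 < y.[- t], 0 < y^`().[- t] & 0 < y^`()^`().[- t]].
    by apply: pos; rewrite tx/=; lra.
  rewrite yN in yt; rewrite dyN in dyt.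
  have : 0 <= (1 + t) * - y^`().[t] by rewrite mulr_ge0 ?(ltW dyt)//; lra.
  have : 0 <= L * y.[t] by rewrite mulr_ge0 ?ltW.
  by lra.
rewrite ger0_norm// in tx.
have pos' s : x < s -> s <= 1 -> [/\ 0 < y.[s], 0 < y^`().[s] & 0 < y^`()^`().[s]].
  by move=> xs s1; apply: pos; rewrite xs.
have [y1 dy1' _] := pos' 1 x1 (lexx 1).
have [yt dyt _] := pos' t tx t1.
(* Far from 1 the function [g] below is nondecreasing on [x, t]. Near 1, convexity gives 2 L y(t) >=
   L y(1) >= 2 y'(1) >= (1 + t) y'(t), so the left side is <= 0. *)
have [far|near_] := leP (2 * lam + 1) (2 * L * (1 - t)).
  have xx : (1 + x) * y^`().[x] - 2 * L * y.[x] <= 20 * L * K.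
    by apply: inner; rewrite ?normr_ge0 ?ger0_norm//; apply/andP; split; lra.
  apply: le_trans xx.
  pose g : {poly R} := (2 * L)%:P * y - (1 + 'X) * y^`().
  have gE s : g.[s] = 2 * L * y.[s] - (1 + s) * y^`().[s].
    by rewrite /g !(hornerD, hornerN, hornerM, hornerC, hornerX).
  suff : g.[x] <= g.[t] by rewrite !gE; lra.
  apply: horner_ndecr; first exact: ltW.
  move=> s /andP[xs st].
  have s1 : s < 1 by rewrite (lt_le_trans st).
  have [ys dys _] := pos' s xs (ltW s1).
  have -> : g^`().[s] = 2 * L * y^`().[s] - ((1 + s) * y^`()^`().[s] + y^`().[s]).
    rewrite /g derivB !derivM derivD derivC derivX -polyC1 derivC.
    by rewrite !(hornerD, hornerN, hornerM, hornerC, hornerX); ring.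
  have s1' : 0 < 1 - s by rewrite subr_gt0.
  (* The factor 1 - s completes (1 + s) y'' to the (1 - s^2) y'' of the equation. *)
  rewrite -(pmulr_rge0 _ s1').
  have E : (1 - s) * (1 + s) * y^`()^`().[s] = (2 * lam + 1) * s * y^`().[s] - L * y.[s].
    by rewrite -ode_t; ring.
  have Ly : 0 <= L * y.[s] by rewrite mulr_ge0 ?ltW.
  have fs : 2 * lam + 1 <= 2 * L * (1 - s).
    apply: le_trans far _; rewrite ler_pM2l ?mulr_gt0//; lra.
  have : 0 <= ((2 * L - 1) * (1 - s) - (2 * lam + 1) * s) * y^`().[s].
    rewrite mulr_ge0 ?(ltW dys)//.
    have : 0 <= 2 * lam * (1 - s) by rewrite mulr_ge0 ?(ltW s1')//; lra.
    by lra.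
  by lra.
have dle s : t <= s -> s <= 1 -> y^`().[s] <= y^`().[1].
  move=> ts s1; apply: horner_ndecr => // r /andP[sr r1].
  have [_ _ ?] := pos' r (lt_le_trans tx (le_trans ts (ltW sr))) (ltW r1).
  exact: ltW.
have H : y.[1] - y.[t] <= y^`().[1] * (1 - t).
  suff : y^`().[1] * t - y.[t] <= y^`().[1] * 1 - y.[1] by lra.
  have := @horner_ndecr _ ((y^`().[1])%:P * 'X - y) t 1 t1.
  rewrite !(hornerD, hornerN, hornerM, hornerC, hornerX); apply.
  move=> s /andP[ts s1].
  rewrite derivB derivM derivC derivX mul0r add0r mulr1 hornerD hornerN hornerC.
  by rewrite subr_ge0 dle ?ltW.
have D1 : 2 * y^`().[1] <= L * y.[1].
  by rewrite dy1 ler_pM2r//; lra.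
have H2 : L * (2 * (y^`().[1] * (1 - t))) <= L * y.[1].
  rewrite dy1 (_ : L * _ = 2 * L * (1 - t) * y^`().[1]); last by ring.
  by rewrite ler_pM2r// ltW.
have H3 : L * (y.[1] - y.[t]) <= L * (y^`().[1] * (1 - t)) by rewrite ler_pM2l.
have H4 : (1 + t) * y^`().[t] <= 2 * y^`().[1].
  by apply: ler_pM => //; [lra|exact: ltW|lra|exact: dle].
by lra.
Qed.

End kernel_bound.

(** * Duality *)

Section mass.
Variables (R : realType) (b : R).
Hypothesis b1 : 1 <= b.
Implicit Types t : R.
Local Notation J := (jacobi_integral b b).

(* The weight is at most 1 and has second moment J 1 / (2 b + 3), so three
   quarters of its mass lie in |t| <= 2 / sqrt (2 b + 3). *)
Lemma jacobi_mass_le : 3 * J 1 * Num.sqrt (2 * b + 3) <= 16.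
Proof.
have B := b1; have b0 : 0 < b by lra.
set r := Num.sqrt (2 * b + 3).
have r2 : r ^+ 2 = 2 * b + 3 by rewrite sqr_sqrtr//; lra.
have r0 : 0 < r by rewrite sqrtr_gt0; lra.
have r2' : 2 <= r by rewrite -(@ler_pXn2r _ 2)// ?nnegrE ?ltW// r2; lra.
have moment : J 1 = r ^+ 2 * J 'X^2.
  have := jacobi_integral_ibp b0 'X.
  rewrite (_ : wderiv (b + 1) 'X = 1 - r ^+ 2 *: 'X^2).
    by rewrite (jacobi_integralB b0) (jacobi_integralZ b0) => /eqP; rewrite subr_eq0 => /eqP.
  rewrite /wderiv derivX -mul_polyC r2.
  have -> : (2 * b + 3)%:P = (2 * (b + 1))%:P + 1 :> {poly R}.
    by rewrite -polyC1 -polyCD; congr (_%:P); ring.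
  by ring.
(* This polynomial is at least -1 for |t| <= 2 / r and nonnegative outside; its integral is J 1 / 4
   - J 1. *)
have := @jacobi_integral_ge_itv R b b0 ((r ^+ 2 / 4) *: 'X^2 - 1) (-1) (- (2 / r)) (2 / r).
have s0 : 0 < 2 / r by rewrite divr_gt0.
have s1 : 2 / r <= 1 by rewrite ler_pdivrMr// mul1r.
move=> /(_ ltac:(lra) ltac:(lra) s1) H.
have {}H : -1 * (2 / r - - (2 / r)) <= J ((r ^+ 2 / 4) *: 'X^2 - 1).
  apply: H => t t11; rewrite /wpoly hornerD hornerN hornerZ hornerXn hornerC.
  have w0 := one_subr_sqr_ge0 t11; have p0 := powR_ge0 (1 - t ^+ 2) b.
  have p1 : (1 - t ^+ 2) `^ b <= 1.
    have e1 : 1 `^ b = 1 :> R by rewrite powR1.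
    rewrite -[leRHS]e1; apply: ge0_ler_powR; rewrite ?nnegrE//; [lra|].
    by rewrite lerBlDr lerDl sqr_ge0.
  case: ifP => [_|/negbT tN].
    have : 0 <= (1 - t ^+ 2) `^ b * (r ^+ 2 / 4 * t ^+ 2).
      by apply: mulr_ge0 => //; apply: mulr_ge0; rewrite ?divr_ge0 ?sqr_ge0.
    by lra.
  apply: mulr_ge0 => //; rewrite subr_ge0 mulrAC ler_pdivlMr// mul1r -exprMn.
  have : 2 < r * `|t|.
    rewrite mulrC -ltr_pdivrMr// ltNge ler_norml.
    exact: tN.
  rewrite (_ : (r * t) ^+ 2 = (r * `|t|) ^+ 2); last by rewrite !exprMn real_normK ?num_real.
  by nra.
move: H; rewrite (jacobi_integralB b0) (jacobi_integralZ b0) => H.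
have {}H : 3 * J 1 <= 16 / r.
  rewrite (_ : 16 / r = 4 * (2 / r + 2 / r)); last by field; rewrite gt_eqF.
  by move: H; rewrite moment; lra.
by rewrite -ler_pdivlMr.
Qed.

End mass.

Section duality.
Variables (R : realType) (d : nat) (l : nat).
Local Notation b := ((d%:R - 3) / 2 : R).
Local Notation P := (sphere_poly R d).
Local Notation J := (jacobi_integral b b).
Local Notation kernel := (dual_kernel (P l)).
Hypotheses (b0 : 0 < b) (l0 : (0 < l)%N).
Implicit Types (s m : nat) (t c g : R).

Let jP s : is_jacobi b b s (P s). Proof. by apply: jacobiP; exact: ltW. Qed.
Let sP s : size (P s) = s.+1. Proof. by case: (jP s). Qed.
Let oP s (q : {poly R}) : (size q <= s)%N -> J (P s * q) = 0.
Proof. by case: (jP s) => _ H _; exact: H. Qed.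
Let P1 s : 0 < (P s).[1].
Proof. by case: (jP s) => _ _ ->; apply: binom_shift_gt0; exact: ltW. Qed.

Let P0 : P 0 = 1.
Proof.
have /size_poly1P[c c0 E] : size (P 0) == 1%N by rewrite sP.
have [_ _] := jP 0; rewrite /binom_shift big_geq// E hornerC => ->.
by rewrite polyC1.
Qed.

Local Notation nrm := (J (P l * P l)).

Let nrm0 : 0 < nrm.
Proof.
apply: jacobi_integral_gt0; rewrite ?ltW//.
  by rewrite mulf_neq0// -size_poly_eq0 sP.
by move=> t _; rewrite hornerM -expr2 sqr_ge0.
Qed.

(** The inequality kappa <= g (J 1) a_0, multiplied by P_l(1) to make kappa explicit. Any c >= l
    will do: c enters only through (c - l) a_l |P_l|^2, which is <= 0. *)
Lemma lp_bound_of_kernel_bound m (a : nat -> R) k c g : (k <= l)%N -> l%:R <= c ->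
  (forall t, -1 <= t <= 1 -> (1 + t) * (P l)^`().[t] - c * (P l).[t] <= g) ->
  lp_feasible d k m a ->
  (2 * l%:R + 2 * b + 1) * nrm <= (P l).[1] * g * J 1 * a 0%N.
Proof.
move=> kl lc Hg [Fge0 F1 ale0]; set F := \sum_(s < m.+1) _ in Fge0 F1.
pose kappa := J kernel.
have kappaE : (P l).[1] * kappa = (2 * l%:R + 2 * b + 1) * nrm.
  exact: (dual_kernel_mass b0 (sP l) (@oP l) l0).
have kappa0 : 0 < kappa.
  rewrite -(pmulr_rgt0 _ (P1 l)) kappaE mulr_gt0//.
  by have B := b0; have : 0 <= (l%:R : R) by []; lra.
pose Q : {poly R} := g%:P - kernel + c%:P * P l.
have JQ (p : {poly R}) : J (p * Q) = g * J p - J (kernel * p) + c * J (P l * p).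
  have -> : p * Q = g *: p - kernel * p + c *: (P l * p).
    by rewrite /Q -!mul_polyC; ring.
  by rewrite (jacobi_integralD b0) (jacobi_integralB b0) !(jacobi_integralZ b0).
have FQ : 0 <= J (F * Q).
  rewrite -(jacobi_integral0 b0); apply: (ler_jacobi_integral b0) => t t11.
  rewrite horner0 hornerM mulr_ge0 ?Fge0//.
  have := Hg t t11; rewrite /Q /dual_kernel !(hornerD, hornerN, hornerM, hornerC, hornerX).
  by lra.
(* Equality for s < l by reproduction. For s >= l the sign of a_s is used: above l the left side is
   0, and at s = l it is (c - l) a_l |P_l|^2. *)
have term s : (s <= m)%N ->
    a s * J (P s * Q) <= (if s == 0%N then g * J 1 * a 0%N else 0) - kappa * (a s * (P s).[1]).
  move=> sm; rewrite JQ.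
  have -> : g * J (P s) = if s == 0%N then g * J 1 else 0.
    case: eqP => [->|/eqP s0]; first by rewrite P0.
    by rewrite -[P s]mulr1 oP ?mulr0// size_poly1 lt0n.
  move: sm; case: (ltngtP s l) => [sl|ls|->] => [_|sm|].
  - rewrite (dual_kernel_reproducing b0 (sP l) (@oP l)) ?sP// oP ?sP//.
    by rewrite -/kappa; case: eqP => [->|_]; lra.
  - have [H1 H2] : J (P s * P l) = 0 /\ J (P s * kernel) = 0.
      by apply: (orth_top_eq0 b0 (sP l)); rewrite sP// => q; exact: oP.
    rewrite [kernel * _]mulrC H2 [P l * _]mulrC H1.
    rewrite gtn_eqF ?(leq_trans _ ls)//.
    have : 0 <= kappa * (- a s * (P s).[1]).
      rewrite mulr_ge0 ?(ltW kappa0)// mulr_ge0 ?(ltW (P1 s))//.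
      by rewrite oppr_ge0 ale0// (leq_trans kl (ltnW ls)).
    by lra.
  - rewrite (dual_kernel_self b0 (sP l) (@oP l)) gtn_eqF//.
    move=> lm; have al : a l <= 0 by rewrite ale0// kl.
    have H1 : 0 <= - a l * ((c - l%:R) * nrm).
      by rewrite mulr_ge0 ?oppr_ge0// mulr_ge0 ?subr_ge0// ltW.
    have H2 : 0 <= kappa * (- a l * (P l).[1]).
      rewrite mulr_ge0 ?(ltW kappa0)// mulr_ge0 ?(ltW (P1 l))//.
      by rewrite oppr_ge0.
    by lra.
have JFQ : J (F * Q) = \sum_(s < m.+1) a s * J (P s * Q).
  rewrite /F mulr_suml (jacobi_integral_sum b0 m.+1 (fun s => a s *: P s * Q)).
  by apply: eq_bigr => s _; rewrite -scalerAl (jacobi_integralZ b0).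
have le_sum : J (F * Q) <= \sum_(s < m.+1)
    ((if s == 0%N :> nat then g * J 1 * a 0%N else 0) - kappa * (a s * (P s).[1])).
  by rewrite JFQ; apply: ler_sum => s _; apply: term; rewrite -ltnS.
have sumE : \sum_(s < m.+1)
    ((if s == 0%N :> nat then g * J 1 * a 0%N else 0) - kappa * (a s * (P s).[1])) =
    g * J 1 * a 0%N - kappa.
  rewrite sumrB -mulr_sumr; congr (_ - _).
    by rewrite big_ord_recl/= big1 ?addr0.
  have <- : F.[1] = \sum_(s < m.+1) a s * (P s).[1].
    by rewrite horner_sum; apply: eq_bigr => s _; rewrite hornerZ.
  by rewrite F1 mulr1.
rewrite -kappaE -!mulrA ler_pM2l//.
by move: (le_trans FQ le_sum); rewrite sumE; lra.
Qed.

End duality.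

(** * Assembly of the constants *)

Theorem proposition1p2 (R : realType) :
  exists C : R, 0 < C /\
    forall (n k l : nat) (rho : R),
      (6 <= n)%N -> (1 <= k)%N ->
      l = (if odd k then k.+1 else k) ->
      is_max_root (jacobi ((n%:R - 5) / 2) ((n%:R - 5) / 2) l) rho ->
      (N_LP R n k <=
        (C * k%:R * (1 / (1 - rho ^+ 2)) `^ ((n%:R - 2) / 4)
          * ((sphere_poly R n l).[1] / sphere_norm R n l))%:E)%E.
Proof.
(* 160 = 20 * 4 * 2: the kernel bound 20 L K, the mass bound 4 / sqrt lam and l <= 2 k. The 2 in L
   <= 2 l (l + lam) cancels the one in kappa. *)
exists 160; split=> // n k l rho n6 k1 lE.
pose lam : R := (n%:R - 2) / 2.
have lam2 : 2 <= lam.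
  have : (6 : R) <= n%:R by rewrite ler_nat.
  by rewrite /lam; lra.
have eb : (n%:R - 3) / 2 = lam - 1 / 2 :> R by rewrite /lam; field.
have eb1 : (n%:R - 5) / 2 = lam - 1 / 2 - 1 :> R by rewrite /lam; field.
have e4 : (n%:R - 2) / 4 = lam / 2 :> R by rewrite /lam; field.
have el : ~~ odd l by rewrite lE; case: ifP => //= ->.
have [kl l2k l2] : [/\ (k <= l)%N, (l <= 2 * k)%N & (2 <= l)%N].
  by rewrite lE; case: ifP => ok; split; lia.
pose y := sphere_poly R n l.
have b0 : 0 < lam - 1 / 2 by lra.
have b1 : 0 < lam - 1 / 2 - 1 by lra.
have [sy oy y1E] : is_jacobi (lam - 1 / 2) (lam - 1 / 2) l y.
  by rewrite -eb; apply: jacobiP; rewrite eb ltW.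
have y1 : 0 < y.[1] by rewrite y1E; apply: binom_shift_gt0; exact: ltW.
rewrite eb1 => rmax.
have [sv ov _] := jacobiP (ltW b1) (ltW b1) l.
have [x [x01 /andP[xrho rho1] rx pos]] := last_roots b1 el l2 sy sv oy ov y1 rmax.
have ode := gegen_ode b0 sy oy.
pose L : R := l%:R * (l%:R + 2 * lam).
pose nrm : R := jacobi_integral (lam - 1 / 2) (lam - 1 / 2) (y * y).
pose K : R := Num.sqrt (lam * nrm / (1 - x ^+ 2) `^ lam).
have upper t : -1 <= t <= 1 -> (1 + t) * y^`().[t] - 2 * L * y.[t] <= 20 * L * K.
  apply: dual_kernel_upper => //.
  - by move=> s; exact: (orth_hornerN b0 sy oy).
  - by move=> s; exact: (orth_derivN b0 sy oy).
  - exact: (orth_simple_root b0 sy oy rx).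
have nrm0 : 0 < nrm.
  apply: jacobi_integral_gt0; rewrite ?ltW//; first by rewrite mulf_neq0// (orth_neq0 sy).
  by move=> t _; rewrite hornerM -expr2 sqr_ge0.
have nuE : sphere_norm R n l = Num.sqrt nrm.
  congr Num.sqrt; rewrite /nrm jacobi_integralE//; apply: eq_Rintegral => t _.
  by rewrite /wpoly hornerM -expr2 mulrC /sphere_weight eb.
set nu := sphere_norm R n l.
have nu0 : 0 < nu by rewrite /nu nuE sqrtr_gt0.
have nu2 : nu ^+ 2 = nrm by rewrite /nu nuE sqr_sqrtr// ltW.
set pr := _ `^ _.
case/andP: x01 => x0 x1.
have wrho : 0 < 1 - rho ^+ 2 by apply: one_subr_sqr_gt0; apply/andP; split; lra.
have wx : 0 < 1 - x ^+ 2 by apply: one_subr_sqr_gt0; apply/andP; split; lra.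
have pr0 : 0 < pr by rewrite powR_gt0// divr_gt0.
have pr2 : 1 <= pr ^+ 2 * (1 - x ^+ 2) `^ lam.
  have -> : pr ^+ 2 = (1 / (1 - rho ^+ 2)) `^ lam.
    rewrite /pr e4 expr2 -powRD -?splitr//.
    by rewrite (gt_eqF (divr_gt0 ltr01 wrho)) implybT.
  have r0 : 0 < 1 / (1 - rho ^+ 2) by rewrite divr_gt0.
  rewrite -(powRM _ (ltW r0) (ltW wx)).
  have e1 : 1 `^ lam = 1 :> R by rewrite powR1.
  apply: (@le_trans _ _ (1 `^ lam)); first by rewrite e1.
  apply: ge0_ler_powR; rewrite ?nnegrE//; first by lra.
    by rewrite mulr_ge0// ltW.
  rewrite mul1r mulrC ler_pdivlMr// mul1r lerB// lerXn2r// nnegrE; lra.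
have sl0 : 0 <= Num.sqrt lam := sqrtr_ge0 lam.
have KE : K <= Num.sqrt lam * nu * pr.
  have A : 0 <= Num.sqrt lam * nu * pr by rewrite !mulr_ge0// ltW.
  rewrite -(@ler_pXn2r _ 2)// ?nnegrE ?sqrtr_ge0//.
  have w0 := powR_gt0 lam wx.
  rewrite sqr_sqrtr; last by rewrite divr_ge0 ?(ltW w0)// mulr_ge0 ?(ltW nrm0)//; lra.
  rewrite ler_pdivrMr// !exprMn sqr_sqrtr ?nu2; last by lra.
  have ln0 : 0 <= lam * nrm by rewrite mulr_ge0 ?(ltW nrm0)//; lra.
  by have := ler_wpM2l ln0 pr2; lra.
pose J : R := jacobi_integral (lam - 1 / 2) (lam - 1 / 2) 1.
have J0 : 0 < J.
  apply: jacobi_integral_gt0; rewrite ?ltW ?oner_neq0// => t _.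
  by rewrite hornerC.
have mass : J * Num.sqrt lam <= 4.
  have bb : 1 <= lam - 1 / 2 by lra.
  have := jacobi_mass_le bb; rewrite -/J.
  (* The factor 4 / 3 turns the 16 / 3 of [jacobi_mass_le] into 4. *)
  have : 4 / 3 * Num.sqrt lam <= Num.sqrt (2 * (lam - 1 / 2) + 3).
    have A : 0 <= 4 / 3 * Num.sqrt lam by rewrite mulr_ge0.
    rewrite -(@ler_pXn2r _ 2)// ?nnegrE ?sqrtr_ge0//.
    rewrite exprMn !sqr_sqrtr; lra.
  move=> H.
  have : J * (4 / 3 * Num.sqrt lam) <= J * Num.sqrt (2 * (lam - 1 / 2) + 3).
    by rewrite ler_pM2l.
  by lra.
have L0 : 0 < L.
  have : (2 : R) <= l%:R by rewrite ler_nat.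
  by move=> A; rewrite /L mulr_gt0//; lra.
have lR : (2 : R) <= l%:R by rewrite ler_nat.
apply: ge_ereal_sup => _ [m [a [feas ->]]]; rewrite lee_fin.
have lL : l%:R <= 2 * L by rewrite /L; nra.
have := @lp_bound_of_kernel_bound R n l; rewrite eb => /(_ b0 (ltnW l2)).
move=> /(_ m a k (2 * L) (20 * L * K) kl lL upper feas).
rewrite -/y -/nrm -/J => H.
have K0 : 0 <= K := sqrtr_ge0 _.
have lN : 0 < 2 * (l%:R + lam) by lra.
have LN : L <= l%:R * (2 * (l%:R + lam)) by rewrite /L ler_wpM2l//; lra.
clearbody K L J.
have c0 : 0 <= y.[1] * (20 * L * K) * J.
  by rewrite !mulr_ge0// ltW.
(* Read off [H]: its left side is positive and the factor of a_0 is nonnegative. *)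
have a0 : 0 < a 0%N.
  rewrite ltNge; apply/negP => a0.
  have := mulr_ge0_le0 c0 a0; apply/negP; rewrite -ltNge.
  by apply: lt_le_trans H; rewrite mulr_gt0//; lra.
have KJ : K * J <= 4 * (nu * pr).
  apply: (@le_trans _ _ (Num.sqrt lam * nu * pr * J)); first by rewrite ler_wpM2r// ltW.
  rewrite (_ : _ * J = J * Num.sqrt lam * (nu * pr)); last by ring.
  by rewrite ler_wpM2r// mulr_ge0// ltW.
have main : nu <= 80 * l%:R * y.[1] * pr * a 0%N.
  have nN : 0 < 2 * (l%:R + lam) * nu by rewrite mulr_gt0.
  rewrite -(ler_pM2l nN).
  apply: (@le_trans _ _ (y.[1] * (20 * L * K) * J * a 0%N)).
    by apply: le_trans H; rewrite -nu2; lra.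
  apply: (@le_trans _ _ (20 * y.[1] * a 0%N * L * (4 * (nu * pr)))).
    rewrite (_ : y.[1] * _ * _ * _ = 20 * y.[1] * a 0%N * L * (K * J)); last by ring.
    by rewrite ler_wpM2l// !mulr_ge0// ltW.
  rewrite (_ : 20 * _ * _ * L * _ = 80 * y.[1] * a 0%N * nu * pr * L); last by ring.
  rewrite [leRHS](_ : _ = 80 * y.[1] * a 0%N * nu * pr * (l%:R * (2 * (l%:R + lam)))); last by ring.
  by rewrite ler_wpM2l// !mulr_ge0// ltW.
rewrite ler_pdivrMr// (_ : _ * a 0%N = 160 * k%:R * pr * y.[1] * a 0%N / nu); last by ring.
rewrite ler_pdivlMr// mul1r; apply: le_trans main _.
have : (l%:R : R) <= 2 * k%:R by rewrite -natrM ler_nat.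
move=> lk.
rewrite (_ : 80 * _ * _ * _ * _ = 80 * (y.[1] * pr * a 0%N) * l%:R); last by ring.
rewrite (_ : 160 * _ * _ * _ * _ = 80 * (y.[1] * pr * a 0%N) * (2 * k%:R)); last by ring.
by rewrite ler_wpM2l// !mulr_ge0// ltW.
Qed.
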